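(* Let $c>0$ and $$G_n^{(c)}=\sqrt{\frac{c^2}{n+c^2}}\left(\frac{(n+c^2)V_n}{(n+c^2)V_n-S_n^2}\right)^{n/2},\qquad n\ge1.$$ If $X_1,X_2,\dots$ are i.i.d. from any distribution with mean $\mu\in\mathbb R$ and variance $\sigma^2\in(0,\infty)$, then $$\lim_{n\to\infty}\frac{\log G_n^{(c)}}{n}=\frac12\log(1+\mu^2/\sigma^2)\quad\text{almost surely}.$$ Consequently, if the distribution is $N(\mu,\sigma^2)$ with $\mu\neq0$, $G_n^{(c)}$ diverges almost surely to $\infty$ exponentially fast (i.e. $\liminf_nn^{-1}\log G_n^{(c)}>0$ almost surely). Furthermore, if the distribution is $N(0,\sigma^2)$ with $\sigma>0$, then $G_n^{(c)}\to0$ almost surely.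
   Context: $S_n=\sum_{i=1}^nX_i$ and $V_n=\sum_{i=1}^nX_i^2$. $N(\mu,\sigma^2)$ is the normal distribution with mean $\mu$ and variance $\sigma^2$. *)

(* Defs.v *)
From mathcomp Require Import all_boot all_order all_algebra.
From mathcomp Require Import all_classical all_reals all_analysis.

Set Implicit Arguments.
Unset Strict Implicit.
Unset Printing Implicit Defensive.

Import Order.TTheory GRing.Theory Num.Theory.
Import numFieldNormedType.Exports.

Local Open Scope classical_set_scope.
Local Open Scope ring_scope.

Section defs.
Context {d : measure_display} {T : measurableType d} {R : realType}.

Definition mutually_independent (P : probability T R)
    (X : nat -> {RV P >-> R}) : Prop :=
  forall (s : seq nat) (A : nat -> set R), uniq s ->
    (forall i, measurable (A i)) ->
    P (\bigcap_(i in [set` s]) (X i @^-1` A i)) =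
    (\prod_(i <- s) P (X i @^-1` A i))%E.

Definition identically_distributed (P : probability T R)
    (X : nat -> {RV P >-> R}) : Prop :=
  forall (i j : nat) (A : set R), measurable A ->
    distribution P (X i) A = distribution P (X j) A.

Definition iid (P : probability T R) (X : nat -> {RV P >-> R}) : Prop :=
  mutually_independent X /\ identically_distributed X.

(* N(mu, sigma^2); [normal_prob] takes the standard deviation, and is a
   normal law only when that is nonzero. *)
Definition has_normal_law (P : probability T R) (Y : {RV P >-> R})
    (mu sigma : R) : Prop :=
  forall A : set R, measurable A -> distribution P Y A = normal_prob mu sigma A.

(* The variables are indexed from 0: [X i] is X_(i+1). *)
Definition partial_sum (X : nat -> T -> R) (n : nat) (w : T) : R :=
  \sum_(i < n) X i w.

Definition partial_sum_sq (X : nat -> T -> R) (n : nat) (w : T) : R :=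
  \sum_(i < n) X i w ^+ 2.

Definition G (c : R) (X : nat -> T -> R) (n : nat) (w : T) : R :=
  let S := partial_sum X n w in
  let V := partial_sum_sq X n w in
  Num.sqrt (c ^+ 2 / (n%:R + c ^+ 2)) *
  (((n%:R + c ^+ 2) * V) / ((n%:R + c ^+ 2) * V - S ^+ 2)) `^ (n%:R / 2).

End defs.

(* Main.v *)
Require Import Defs.
From mathcomp Require Import all_boot all_order all_algebra.
From mathcomp Require Import all_classical all_reals all_analysis.
From mathcomp Require Import measurable_realfun.
From mathcomp Require Import ring lra.

Set Implicit Arguments.
Unset Strict Implicit.
Unset Printing Implicit Defensive.

Import Order.TTheory GRing.Theory Num.Theory.
Import numFieldNormedType.Exports.

Local Open Scope classical_set_scope.
Local Open Scope ring_scope.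

(** The growth rate follows from the strong law of large numbers for [X_i] and
    [X_i^2], since [log G_n / n] is, up to [O(log n / n)], a continuous function
    of the two empirical means.  As [X_i^2] is only integrable, the strong law is
    proved in Etemadi's way: along [k_n = floor (alpha ^ n)] the variables are
    truncated at the level [k_n], second moments control the truncated means, and
    monotonicity of the partial sums fills the gaps.

    For a centred normal law [log G_n] is at most
    [- log n / 2 + S_n^2 / (n E X^2) + O(1)], so it suffices that
    [S_n^2 = o(n log n)] almost surely.  This only needs fourth moments: a dyadic
    maximal inequality gives [E max_(j <= 2^k) S_j^4 <= C 4^k], and
    [sum_k 1 / k^2] converges. *)

(** Truncation at [k] leaves two errors, the fluctuation of the truncated mean and the number of
    truncated variables. Both are controlled by E min(Y, k)^2 / k. Along a geometric sequence of
    levels the values min(y, k)^2 / k decay geometrically on both sides of k = y, so their sum is at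
    most a constant times y, and one finite first moment pays for everything. Monotone partial sums
    require nonnegative variables; signed ones are split into positive and negative parts.

    In the maximal inequality, doubling a block may multiply the bound by 4 at most. A partial sum
    of the doubled block lies in the first half or is the full first half plus a partial sum of the
    second. The convexity bound (x + y)^4 <= 8 x^4 + 8 y^4 would give the two halves total weight 1
    + 8 > 4. The unbalanced coefficients 125 and 2 give weight 1 + 2 = 3 < 4, and the large one
    falls on the sum of a fixed block, whose moment is known. Second moments leave no such room:
    their factor is 2, and the weights already exceed 1 + 1. *)

(** By monotone convergence the series of the [f n] has a finite integral, hence is finite almost
    everywhere, and each term is at most a tail of the series. This takes the place of Markov's
    inequality with Borel-Cantelli. *)
Lemma ae_cvg0_of_summable_integral (d : measure_display) (T : measurableType d)
    (R : realType) (mu : {measure set T -> \bar R}) (f : nat -> T -> R) :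
  (forall n, measurable_fun [set: T] (f n)) ->
  (forall n w, 0 <= f n w) ->
  (\sum_(0 <= n <oo) \int[mu]_w (f n w)%:E < +oo)%E ->
  {ae mu, forall w, f n w @[n --> \oo] --> (0 : R)}.
Proof.
move=> mf f0; rewrite -integral_nneseries//; last 2 first.
- by move=> n; exact/measurable_EFinP.
- by move=> n w _; rewrite lee_fin.
move=> sumfoo; pose g w := (\sum_(0 <= n <oo) (f n w)%:E)%E.
have g0 w : (0 <= g w)%E by apply: nneseries_ge0 => n _ _; rewrite lee_fin.
have mg : measurable_fun [set: T] g.
  apply: ge0_emeasurable_sum => [n w _ _|n _]; first by rewrite lee_fin.
  exact/measurable_EFinP.
have intg : mu.-integrable [set: T] g.
  by apply/integrableP; split => //; under eq_integral do rewrite gee0_abs//.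
apply: filterS (integrable_ae measurableT intg) => w /(_ I) gw.
have /nneseries_tail_cvg tail0 : (\sum_(0 <= n <oo) (f n w)%:E < +oo)%E.
  by move: gw; rewrite ge0_fin_numE.
have {}tail0 := tail0 (fun k _ => f0 k w).
suff /fine_cvgP[_] : (f n w)%:E @[n --> \oo] --> (0 : R)%:E by [].
apply: (squeeze_cvge _ (cvg_cst 0%E) tail0); apply: nearW => n /=.
rewrite lee_fin f0/= (nneseries_split n 1); last by move=> *; rewrite lee_fin.
by rewrite addn1 big_nat1 leeDl// nneseries_ge0// => k _ _; rewrite lee_fin.
Qed.

(** * Independence *)

Section independence.
Context (d : measure_display) (T : measurableType d) (R : realType).
Variable P : probability T R.
Implicit Types A B : T -> R.
Local Open Scope ereal_scope.

Definition indep2 A B := forall U V : set R, measurable U -> measurable V ->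
  P (A @^-1` U `&` B @^-1` V) = P (A @^-1` U) * P (B @^-1` V).

Lemma measurable_preimage A (U : set R) :
  measurable_fun setT A -> measurable U -> measurable (A @^-1` U).
Proof. by move=> mA mU; rewrite -[_ @^-1` _]setTI; exact: mA. Qed.

Lemma indep2_comp A B (f g : R -> R) :
    measurable_fun setT f -> measurable_fun setT g ->
  indep2 A B -> indep2 (f \o A) (g \o B).
Proof.
move=> mf mg AB U V mU mV; apply: (AB (f @^-1` U) (g @^-1` V)).
  by rewrite -[_ @^-1` _]setTI; exact: mf.
by rewrite -[_ @^-1` _]setTI; exact: mg.
Qed.

(** Dynkin's argument: the sets [C] that satisfy the identity form a Dynkin system, and the
    rectangles are a generating pi-system. General [C] are needed for events about [A + B], whose
    preimage in the plane is not a rectangle. *)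
Lemma pair_indep_event A B (E : set T) :
    measurable_fun setT A -> measurable_fun setT B -> measurable E ->
    (forall U V : set R, measurable U -> measurable V ->
      P (A @^-1` U `&` B @^-1` V `&` E) = P (A @^-1` U `&` B @^-1` V) * P E) ->
  forall C : set (R * R), measurable C ->
    P ((fun w => (A w, B w)) @^-1` C `&` E) =
    P ((fun w => (A w, B w)) @^-1` C) * P E.
Proof.
move=> mA mB mE ABE C mC; set AB := fun w => (A w, B w).
have mAB : measurable_fun setT AB by exact: measurable_fun_pair.
have mABC D : measurable D -> measurable (AB @^-1` D).
  by move=> mD; rewrite -[_ @^-1` _]setTI; exact: mAB.
pose Q D := P (AB @^-1` D `&` E) = P (AB @^-1` D) * P E.
pose G := [set U `*` V | U in @measurable _ R & V in @measurable _ R].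
have mG : @measurable _ (R * R)%type = <<s G >>.
  exact: measurable_prod_measurableType.
suff : forall D, <<s G >> D -> Q D by apply; rewrite -mG.
apply: dynkin_induction => //.
- move=> _ _ [U mU] [V mV <-] [U' mU'] [V' mV' <-].
  exists (U `&` U'); first exact: measurableI.
  by exists (V `&` V'); [exact: measurableI|rewrite setXI].
- by rewrite /Q preimage_setT setTI probability_setT mul1e.
- by move=> _ [U mU] [V mV <-]; exact: ABE.
- move=> D mD; have := mABC _ mD; rewrite /Q; set X := AB @^-1` D => mX QD.
  rewrite -[AB @^-1` (~` D)]/(~` X) setIC -setDE measureD//; last first.
    by rewrite (le_lt_trans (probability_le1 _ _))// ltry.
  rewrite (setIC E) [X in _ - X]QD probability_setC// muleBl ?mul1e//.
  exact: fin_num_measure.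
- move=> F mF tF QF.
  have tABF : trivIset setT (fun i => AB @^-1` F i).
    apply/trivIsetP => i j _ _ ij; move/trivIsetP : tF => /(_ i j I I ij) FF.
    by rewrite -preimage_setI FF preimage_set0.
  rewrite /Q preimage_bigcup setI_bigcupl.
  have mABF i : measurable (AB @^-1` F i) by exact: mABC.
  have mABFE i : measurable (AB @^-1` F i `&` E) by exact: measurableI.
  have tABFE : trivIset setT (fun i => AB @^-1` F i `&` E).
    exact: trivIset_setIr.
  rewrite measure_bigcup// [X in _ = X * _]measure_bigcup//.
  have /fineK <- : P E \is a fin_num by exact: fin_num_measure.
  rewrite muleC -nneseriesZl//.
  apply: eq_eseriesr => i _; rewrite [LHS]QF muleC fineK//.
  exact: fin_num_measure.
Qed.

(* Mutual independence passes from the family to the partial sums by absorbing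
   one variable at a time. *)
Lemma partial_sum_indep_event (X : nat -> {RV P >-> R}) :
    mutually_independent X ->
  forall (n : nat) (s : seq nat) (A : nat -> set R) (U : set R),
    uniq s -> all (leq n) s -> (forall i, measurable (A i)) -> measurable U ->
    let E := \bigcap_(i in [set` s]) (X i @^-1` A i) in
    P (partial_sum X n @^-1` U `&` E) = P (partial_sum X n @^-1` U) * P E.
Proof.
move=> indX; have mX i : measurable_fun setT (X i) by exact: measurable_funP.
have mS n : measurable_fun setT (partial_sum X n) by exact: measurable_sum.
elim=> [|n IH] s A U us sn mA mU /=.
  have -> : partial_sum X 0 = cst 0%R.
    by apply/funext => w; rewrite /partial_sum big_ord0.
  rewrite preimage_cst; case: ifPn => _.
    by rewrite setTI probability_setT mul1e.
  by rewrite set0I measure0 mul0e.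
have ms (A' : nat -> set R) : (forall i, measurable (A' i)) -> forall s' : seq nat,
    measurable (\bigcap_(i in [set` s']) (X i @^-1` A' i)).
  move=> mA' s'; apply: fin_bigcap_measurable => [|i _]; first exact: finite_seq.
  exact: measurable_preimage.
set E := \bigcap_(_ in _) _.
have nns : n \notin s by apply/negP => /(allP sn); rewrite ltnn.
have key V W : measurable V -> measurable W ->
    P (partial_sum X n @^-1` V `&` X n @^-1` W `&` E) =
    P (partial_sum X n @^-1` V) * P (X n @^-1` W) * P E.
  (* Overriding the set at [n] makes the event on [X n] one more index of the intersection, so the
     induction hypothesis applies to [n :: s]. *)
  move=> mV mW; pose A' i := if i == n then W else A i.
  have mA' i : measurable (A' i) by rewrite /A'; case: ifP.
  have EE : E = \bigcap_(i in [set` s]) (X i @^-1` A' i).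
    apply: eq_bigcapr => i /= si; rewrite /A'; case: eqP => // in_.
    by move: nns; rewrite -in_ si.
  have E'E : X n @^-1` W `&` E = \bigcap_(i in [set` n :: s]) (X i @^-1` A' i).
    rewrite EE; apply/seteqP; split=> w /=.
      move=> [Ww sw] i /=; rewrite inE => /predU1P[->|]; last exact: sw.
      by rewrite /A' eqxx.
    move=> nsw; split; last by move=> i si; apply: nsw; rewrite /= inE si orbT.
    by have := nsw n; rewrite /A' /= eqxx inE eqxx => /(_ isT).
  rewrite -setIA E'E (IH (n :: s))//=; last 2 first.
  - by rewrite nns.
  - by rewrite leqnn/=; apply: sub_all sn => i; exact: ltnW.
  rewrite indX//=; last by rewrite nns.
  by rewrite big_cons {1}/A' eqxx EE indX// muleA.
(* The first two factors are merged again, by the induction hypothesis for the list [[:: n]], to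
   reach the form that [pair_indep_event] expects. *)
have key2 V W : measurable V -> measurable W ->
    P (partial_sum X n @^-1` V `&` X n @^-1` W `&` E) =
    P (partial_sum X n @^-1` V `&` X n @^-1` W) * P E.
  move=> mV mW; rewrite key//; congr (_ * _).
  pose A' i := if i == n then W else A i.
  have mA' i : measurable (A' i) by rewrite /A'; case: ifP.
  have := IH [:: n] A' V erefl; rewrite /= leqnn => /(_ isT mA' mV).
  have -> : \bigcap_(i in [set` [:: n]]) (X i @^-1` A' i) = X n @^-1` W.
    by rewrite set_cons1 bigcap_set1 /A' eqxx.
  by [].
have mp : measurable_fun [set: R * R] (fun x : R * R => (x.1 + x.2)%R).
  exact: measurable_funD.
have := @pair_indep_event (partial_sum X n) (X n) E (mS n) (mX n) (ms _ mA s) key2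
  ((fun x => (x.1 + x.2)%R) @^-1` U).
have -> : (fun w => (partial_sum X n w, X n w)) @^-1` ((fun x => (x.1 + x.2)%R) @^-1` U)
  = partial_sum X n.+1 @^-1` U.
  by apply/seteqP; split => w; rewrite /preimage/= /partial_sum big_ord_recr.
by apply; rewrite -[_ @^-1` _]setTI; exact: mp.
Qed.

Lemma partial_sum_indep2 (X : nat -> {RV P >-> R}) (n : nat) :
  mutually_independent X -> indep2 (partial_sum X n) (X n).
Proof.
move=> indX U V mU mV.
have := @partial_sum_indep_event X indX n [:: n] (fun=> V) U erefl.
rewrite /= leqnn => /(_ isT (fun=> mV) mU).
by rewrite set_cons1 bigcap_set1.
Qed.

(** The joint law agrees with the product of the marginals on rectangles, hence everywhere. Tonelli
    for |x y| then gives integrability, and Fubini gives the value. *)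
Lemma indep2_integrableM A B : measurable_fun setT A -> measurable_fun setT B ->
    indep2 A B -> P.-integrable setT (EFin \o A) ->
    P.-integrable setT (EFin \o B) ->
  P.-integrable setT (EFin \o (A \* B)%R) /\
  \int[P]_w (A w * B w)%:E = (\int[P]_w (A w)%:E) * (\int[P]_w (B w)%:E).
Proof.
move=> mA mB AB iA iB.
pose A' : {RV P >-> R} := mfun_Sub (mem_set mA).
pose B' : {RV P >-> R} := mfun_Sub (mem_set mB).
have mp : measurable_fun setT (fun w => (A w, B w)) by exact: measurable_fun_pair.
pose C : {RV P >-> (R * R)%type} := mfun_Sub (mem_set mp).
pose mA1 := distribution P A'; pose mB1 := distribution P B'.
have prodE X : measurable X -> (mA1 \x mB1) X = distribution P C X.
  by apply: product_measure_unique => U V mU mV; exact: AB.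
have mf : measurable_fun setT (fun x : R * R => (x.1 * x.2)%:E).
  apply/measurable_EFinP/measurable_funM; first exact: measurable_fst.
  exact: measurable_snd.
have mnorm : measurable_fun setT (fun x : R => `|x|%:E).
  by apply/measurable_EFinP; exact: normr_measurable.
have mid : measurable_fun setT (fun x : R => x%:E) by exact/measurable_EFinP.
have abs_fin D : P.-integrable setT (EFin \o D) -> \int[P]_w `|(D w)%:E| < +oo.
  by case/integrableP.
have normE : \int[P]_w `|(A w * B w)%:E| =
    (\int[P]_w `|(A w)%:E|) * (\int[P]_w `|(B w)%:E|).
  transitivity (\int[distribution P C]_x `|(x.1 * x.2)%:E|).
    by rewrite ge0_integral_distribution//; exact: measurableT_comp.
  rewrite -(@eq_measure_integral _ _ _ _ _ (mA1 \x mB1)); last first.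
    by move=> X mX _; exact: prodE.
  rewrite fubini_tonelli1//; last exact: measurableT_comp.
  have -> : fubini_F mB1 (fun x : R * R => `|(x.1 * x.2)%:E|) =
      fun x => `|x%:E| * \int[P]_w `|(B w)%:E|.
    apply/funext => x; rewrite /fubini_F/=.
    under eq_integral do rewrite normrM EFinM.
    rewrite ge0_integralZl_EFin//.
    by rewrite ge0_integral_distribution.
  rewrite ge0_integralZr//; last exact: integral_ge0.
  by rewrite ge0_integral_distribution.
have iAB : P.-integrable setT (EFin \o (A \* B)%R).
  apply/integrableP; split; first exact/measurable_EFinP/measurable_funM.
  rewrite [ltLHS]normE lte_mul_pinfty ?abs_fin// ?integral_ge0//.
  by rewrite ge0_fin_numE ?abs_fin// integral_ge0.
split=> //.
have finB : \int[P]_w (B w)%:E \is a fin_num by exact: integrable_fin_num.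
transitivity (\int[distribution P C]_x (x.1 * x.2)%:E).
  by rewrite integral_distribution.
rewrite -(@eq_measure_integral _ _ _ _ _ (mA1 \x mB1)); last first.
  by move=> X mX _; exact: prodE.
rewrite -integral12_prod_meas1//; last first.
  apply/integrableP; split => //.
  rewrite (@eq_measure_integral _ _ _ _ (distribution P C)); last first.
    by move=> X mX _; exact: prodE.
  rewrite ge0_integral_distribution//; last exact: measurableT_comp.
  by case/integrableP : iAB.
have -> : fubini_F mB1 (fun x : R * R => (x.1 * x.2)%:E) =
    fun x => x%:E * \int[P]_w (B w)%:E.
  apply/funext => x; rewrite /fubini_F/=.
  under eq_integral do rewrite EFinM.
  rewrite -(integral_distribution (X := B'))//.
  rewrite integralZl//.
  apply/integrableP; split => //.
  rewrite ge0_integral_distribution//.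
  exact: abs_fin.
rewrite -(fineK finB) integralZr//.
  by rewrite integral_distribution//; exact mid.
apply/integrableP; split => //.
rewrite ge0_integral_distribution//.
exact: abs_fin.
Qed.

End independence.

(** * Integrability and moments of independent sums *)

Section moments.
Context (d : measure_display) (T : measurableType d) (R : realType).
Variable P : probability T R.
Implicit Types f g : T -> R.

Definition L1 f := P.-integrable [set: T] (EFin \o f).

Lemma L1_measurable f : L1 f -> measurable_fun [set: T] f.
Proof. by move=> /integrableP[/measurable_EFinP]. Qed.

Lemma L1_le f g : measurable_fun [set: T] f -> (forall w, `|f w| <= g w) ->
  L1 g -> L1 f.
Proof.
move=> mf fg; apply: le_integrable => //; first exact/measurable_EFinP.
by move=> w _ /=; rewrite lee_fin (le_trans (fg w)) ?ler_norm.
Qed.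

Lemma L1_cst (c : R) : L1 (fun=> c).
Proof. exact: finite_measure_integrable_cst. Qed.

Lemma L1D f g : L1 f -> L1 g -> L1 (fun w => f w + g w).
Proof. exact: integrableD. Qed.

Lemma L1B f g : L1 f -> L1 g -> L1 (fun w => f w - g w).
Proof. exact: integrableB. Qed.

Lemma L1Z (c : R) f : L1 f -> L1 (fun w => c * f w).
Proof. exact: integrableZl. Qed.

Lemma L1_sum (I : Type) (s : seq I) (f : I -> T -> R) :
  (forall i, L1 (f i)) -> L1 (fun w => \sum_(i <- s) f i w).
Proof.
move=> fL1; elim: s => [|i s IHs].
  by under eq_fun do rewrite big_nil; exact: L1_cst.
by under eq_fun do rewrite big_cons; exact: L1D.
Qed.

Lemma RintegralT_cst (c : R) : Rintegral P [set: T] (fun=> c) = c.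
Proof.
have := expectation_cst P c; rewrite unlock /Rintegral.
by move=> /(congr1 fine).
Qed.

Lemma normX_le_1Dpow4 (a : R) (k : nat) : (k <= 4)%N ->
  `|a ^+ k| <= 1 + a ^+ 4.
Proof.
move=> k4; have a4 : a ^+ 4 = `|a| ^+ 4 by rewrite -normrX ger0_norm// exprn_even_ge0.
rewrite a4 normrX; have [a1|/ltW a1] := leP `|a| 1.
  by rewrite (@le_trans _ _ 1) ?exprn_ile1// lerDl exprn_ge0.
by rewrite (@le_trans _ _ (`|a| ^+ 4)) ?ler_weXn2l// lerDr.
Qed.

Lemma L1_pow4 f (k : nat) : measurable_fun [set: T] f ->
  L1 (fun w => f w ^+ 4) -> (k <= 4)%N -> L1 (fun w => f w ^+ k).
Proof.
move=> mf f4 k4; apply: (@L1_le _ (fun w => 1 + f w ^+ 4)).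
- exact: measurable_funX.
- by move=> w; exact: normX_le_1Dpow4.
- by apply: L1D => //; exact: L1_cst.
Qed.

Lemma indep2_powM f g (j k : nat) :
    measurable_fun [set: T] f -> measurable_fun [set: T] g -> indep2 P f g ->
    L1 (fun w => f w ^+ j) -> L1 (fun w => g w ^+ k) ->
  L1 (fun w => f w ^+ j * g w ^+ k) /\
  \int[P]_w (f w ^+ j * g w ^+ k) =
    (\int[P]_w (f w ^+ j)) * (\int[P]_w (g w ^+ k)).
Proof.
move=> mf mg fg fj gk.
have mX n : measurable_fun [set: R] (fun x => x ^+ n) by exact: measurable_funX.
have fgjk := indep2_comp (mX j) (mX k) fg.
have [i1 e1] := indep2_integrableM (L1_measurable fj) (L1_measurable gk) fgjk fj gk.
split; first exact: i1.
by rewrite /Rintegral e1 fineM// integrable_fin_num.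
Qed.

(** In the expansion of (S + Y)^4 with [S] and [Y] independent and centred, every term with a first
    power vanishes, leaving S^4 + 6 S^2 Y^2 + Y^4. The middle term adds at most 6 n v^2, less than
    the increment 3 ((n + 1)^2 - n^2) v^2. The moments are bounded in one induction since the fourth
    calls on the second. *)
Lemma partial_sum_moments (X : nat -> {RV P >-> R}) (v q : R) :
    mutually_independent X ->
    (forall i, L1 (fun w => X i w ^+ 4)) ->
    (forall i, \int[P]_w X i w = 0) ->
    (forall i, \int[P]_w (X i w ^+ 2) <= v) ->
    (forall i, \int[P]_w (X i w ^+ 4) <= q) ->
  forall n, let S := partial_sum X n in
  [/\ L1 (fun w => S w ^+ 4), \int[P]_w S w = 0,
      \int[P]_w (S w ^+ 2) <= n%:R * v &
      \int[P]_w (S w ^+ 4) <= n%:R * q + 3 * n%:R ^+ 2 * v ^+ 2].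
Proof.
move=> indX X4 X1 X2 Xq; elim=> [|n [S4 ES ES2 ES4]] /=.
  have -> : partial_sum X 0 = fun=> 0.
    by apply/funext => w; rewrite /partial_sum big_ord0.
  rewrite !expr0n/= !mul0r !mulr0 mul0r addr0.
  split; [exact: L1_cst| | |]; by rewrite RintegralT_cst.
have mS m : measurable_fun [set: T] (partial_sum X m) by exact: measurable_sum.
have mX i : measurable_fun [set: T] (X i) by [].
set S := partial_sum X n in S4 ES ES2 ES4; set Y : T -> R := X n.
have SE : partial_sum X n.+1 = fun w => S w + Y w.
  by apply/funext => w; rewrite /partial_sum big_ord_recr.
have SY := partial_sum_indep2 n indX.
have Sk k : (k <= 4)%N -> L1 (fun w => S w ^+ k).
  by move=> k4; apply: L1_pow4 => //; exact: mS.
have Yk k : (k <= 4)%N -> L1 (fun w => Y w ^+ k).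
  by move=> k4; apply: L1_pow4 => //; exact: X4.
have SYk j k (j4 : (j <= 4)%N) (k4 : (k <= 4)%N) :=
  @indep2_powM S Y j k (mS n) (mX n) SY (Sk _ j4) (Yk _ k4).
(* The exponent 1 stays explicit so that the mixed terms match [indep2_powM]. *)
have ES0 : \int[P]_w (S w ^+ 1) = 0 by rewrite -[RHS]ES.
have EY0 : \int[P]_w (Y w ^+ 1) = 0 by rewrite -[RHS](X1 n).
have v0 : 0 <= v.
  by apply: le_trans (X2 0%N); apply: Rintegral_ge0 => w _; exact: sqr_ge0.
have ES20 : 0 <= \int[P]_w (S w ^+ 2).
  by apply: Rintegral_ge0 => w _; exact: sqr_ge0.
have EY20 : 0 <= \int[P]_w (Y w ^+ 2).
  by apply: Rintegral_ge0 => w _; exact: sqr_ge0.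
have [L31 E31] := SYk 3 1 isT isT; have [L13 E13] := SYk 1 3 isT isT.
have [L22 E22] := SYk 2 2 isT isT; have [L11 E11] := SYk 1 1 isT isT.
have L4 : L1 (fun w => S w ^+ 4 + 4 * (S w ^+ 3 * Y w ^+ 1) +
    6 * (S w ^+ 2 * Y w ^+ 2) + 4 * (S w ^+ 1 * Y w ^+ 3) + Y w ^+ 4).
  by do !apply: L1D; do ?apply: L1Z; rewrite ?Sk ?Yk.
have E4 : (fun w => (S w + Y w) ^+ 4) = (fun w => S w ^+ 4 + 4 * (S w ^+ 3 * Y w ^+ 1) +
    6 * (S w ^+ 2 * Y w ^+ 2) + 4 * (S w ^+ 1 * Y w ^+ 3) + Y w ^+ 4).
  by apply/funext => w; ring.
rewrite SE; split.
- by rewrite E4.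
- rewrite RintegralD//; [by rewrite ES [X in _ + X]X1 addr0|exact: (Sk 1%N)|exact: (Yk 1%N)].
- have -> : (fun w => (S w + Y w) ^+ 2) =
      fun w => S w ^+ 2 + 2 * (S w ^+ 1 * Y w ^+ 1) + Y w ^+ 2.
    by apply/funext => w; ring.
  rewrite RintegralD//; [|by apply: L1D; [exact: Sk|exact: L1Z]|exact: Yk].
  rewrite RintegralD//; [|exact: Sk|exact: L1Z].
  rewrite RintegralZl// E11 ES0 mul0r mulr0 addr0 -[n.+1%:R]natr1 mulrDl mul1r.
  by rewrite lerD// X2.
rewrite [X in Rintegral _ _ X]E4.
rewrite RintegralD//; [|by do !apply: L1D; do ?apply: L1Z; rewrite ?Sk ?Yk|exact: Yk].
rewrite RintegralD//; [|by do !apply: L1D; do ?apply: L1Z; rewrite ?Sk ?Yk|exact: L1Z].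
rewrite RintegralD//; [|by do !apply: L1D; do ?apply: L1Z; rewrite ?Sk ?Yk|exact: L1Z].
rewrite RintegralD//; last exact: L1Z.
rewrite !RintegralZl// E31 E22 E13 ES0 EY0 mul0r !mulr0 !addr0.
have EYv := X2 n; have EYq := Xq n.
have SYv : \int[P]_w (S w ^+ 2) * \int[P]_w (Y w ^+ 2) <= n%:R * v * v.
  by apply: ler_pM.
have n0 : 0 <= n%:R :> R by [].
have v20 : 0 <= v ^+ 2 by exact: sqr_ge0.
rewrite -[n.+1%:R]natr1.
apply: (@le_trans _ _ (n%:R * q + 3 * n%:R ^+ 2 * v ^+ 2 + 6 * (n%:R * v * v) + q)).
  by apply: lerD => //; apply: lerD => //; rewrite ler_pM2l.
rewrite -subr_ge0 (_ : _ - _ = 3 * v ^+ 2) ?mulr_ge0//; ring.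
Qed.

End moments.

(** * Images, shifts and integrals of i.i.d. families *)

Section families.
Context (d : measure_display) (T : measurableType d) (R : realType).
Variable P : probability T R.
Implicit Types X : nat -> {RV P >-> R}.

Lemma mutually_independent_comp X (f : nat -> {mfun R >-> R}) :
  mutually_independent X ->
  mutually_independent (fun i => [the {mfun T >-> R} of f i \o X i] : {RV P >-> R}).
Proof.
move=> indX s A us mA; apply: (indX s (fun i => f i @^-1` A i)) => // i.
by rewrite -[_ @^-1` _]setTI; exact: measurable_funP.
Qed.

Lemma mutually_independent_shift X (a : nat) :
  mutually_independent X -> mutually_independent (fun i => X (a + i)%N).
Proof.
move=> indX s A us mA.
(* Only indices of the form [a + i] occur, so the truncated subtraction is exact. *)
have := indX (map (addn a) s) (fun j => A (j - a)%N).
rewrite map_inj_uniq; last exact: addnI.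
move=> /(_ us (fun i => mA _)); rewrite big_map.
under [X in _ = X -> _]eq_bigr do rewrite addKn.
move=> <-; congr (P _); apply/seteqP; split => w /= wA i /=.
  by move=> /mapP[j js ->]; rewrite addKn; exact: wA.
by move=> si; have := wA (a + i)%N; rewrite /= addKn; apply; exact: map_f.
Qed.

Lemma iid_comp X (f : {mfun R >-> R}) : iid X ->
  iid (fun i => [the {mfun T >-> R} of f \o X i] : {RV P >-> R}).
Proof.
move=> [indX idX]; split; first exact: (mutually_independent_comp (fun=> f)).
move=> i j A mA; apply: (idX i j (f @^-1` A)).
by rewrite -[_ @^-1` _]setTI; exact: measurable_funP.
Qed.

Lemma identically_distributed_integral X (f : R -> \bar R) (i j : nat) :
    identically_distributed X ->
    measurable_fun [set: R] f -> (forall x, 0 <= f x)%E ->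
  (\int[P]_w f (X i w) = \int[P]_w f (X j w))%E.
Proof.
move=> idX mf f0.
rewrite -[LHS](ge0_integral_distribution (X i) mf f0).
rewrite -[RHS](ge0_integral_distribution (X j) mf f0).
by apply: eq_measure_integral => A mA _; exact: idX.
Qed.

Lemma identically_distributed_L1 X (f : R -> R) (i j : nat) :
    identically_distributed X -> measurable_fun [set: R] f ->
  L1 P (f \o X i) -> L1 P (f \o X j).
Proof.
move=> idX mf /integrableP[_ fi]; apply/integrableP; split.
  by apply/measurable_EFinP; exact: measurableT_comp.
apply: le_lt_trans fi; rewrite le_eqVlt; apply/orP; left; apply/eqP.
apply: (@identically_distributed_integral X (fun x => `|(f x)%:E|%E)) => //.
by apply: measurableT_comp => //; exact/measurable_EFinP.
Qed.

Lemma identically_distributed_Rintegral X (f : R -> R) (i j : nat) :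
    identically_distributed X -> measurable_fun [set: R] f ->
    L1 P (f \o X i) ->
  \int[P]_w f (X i w) = \int[P]_w f (X j w).
Proof.
move=> idX mf fi; have fj := @identically_distributed_L1 X f i j idX mf fi.
have mf' : measurable_fun [set: R] (EFin \o f) by exact/measurable_EFinP.
rewrite /Rintegral; congr fine.
rewrite -[LHS](integral_distribution (X := X i) mf' fi).
rewrite -[RHS](integral_distribution (X := X j) mf' fj).
by apply: eq_measure_integral => A mA _; exact: idX.
Qed.

End families.

(** * Geometric subsequences: truncation sums and interpolation *)

Section geometric_subsequence.
Context (R : realType).
Implicit Types (y a alpha : R) (n : nat).

Definition geom alpha n : nat := Num.truncn (alpha ^+ n).

Lemma geom_le alpha n : 1 < alpha -> (geom alpha n)%:R <= alpha ^+ n.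
Proof. by move=> a1; rewrite truncn_le exprn_ge0// ltW// (lt_trans ltr01). Qed.

Lemma geom_gt alpha n : alpha ^+ n < (geom alpha n)%:R + 1.
Proof. by rewrite natr1; exact: truncnS_gt. Qed.

Lemma geom_gt0 alpha n : 1 < alpha -> (0 < geom alpha n)%N.
Proof. by move=> a1; rewrite truncn_gt0 exprn_ege1// ltW. Qed.

(* Telescopes: [y * a / (a + y)] increases in [a] from 0 to [y]. *)
Lemma min_sqr_telescope y a alpha : 1 < alpha -> 0 <= y -> 0 < a ->
  Num.min y a ^+ 2 / a <= 4 * alpha / (alpha - 1) *
    (alpha * a * y / (alpha * a + y) - a * y / (a + y)).
Proof.
move=> a1 y0 a0; set m := Num.min y a.
have a0' : 0 < alpha by exact: lt_trans a1.
have aa0 : 0 < alpha * a by exact: mulr_gt0.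
have s0 : 0 < a + y by exact: ltr_pwDl.
have s1 : 0 < alpha * a + y by exact: ltr_pwDl.
have m0 : 0 <= m by rewrite le_min y0 ltW.
have my : m <= y by rewrite ge_min lexx.
have ma : m <= a by rewrite ge_min lexx orbT.
(* The minimum of two numbers is at most their harmonic mean; [h2] is the same bound one step
   further, at the cost of a factor [alpha]. *)
have h1 : m * (a + y) <= 2 * (a * y).
  by rewrite mulrDr; have := ler_wpM2r (ltW a0) my; have := ler_wpM2r y0 ma; lra.
have h2 : m * (alpha * a + y) <= 2 * (alpha * (a * y)).
  apply: (@le_trans _ _ (alpha * (m * (a + y)))).
    have : m * y <= alpha * (m * y) by rewrite ler_peMl ?mulr_ge0// ltW.
    nra.
  by have := ler_wpM2l (ltW a0') h1; lra.
have h3 : m ^+ 2 * ((a + y) * (alpha * a + y)) <= 4 * (alpha * (a * y) ^+ 2).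
  rewrite (_ : _ * _ = m * (a + y) * (m * (alpha * a + y))); last by ring.
  apply: (@le_trans _ _ (2 * (a * y) * (2 * (alpha * (a * y))))).
    by apply: ler_pM => //; rewrite mulr_ge0// ltW.
  by rewrite le_eqVlt; apply/orP; left; apply/eqP; ring.
rewrite (_ : 4 * alpha / (alpha - 1) * _ =
    4 * (alpha * (a * y) ^+ 2) / ((a + y) * (alpha * a + y)) / a); last first.
  by field; rewrite !gt_eqF// subr_gt0.
by rewrite ler_pM2r ?invr_gt0// ler_pdivlMr// mulr_gt0.
Qed.

(** A bound linear in [y] and uniform in [N] is what turns second moments of truncated variables
    into a first moment. The telescoping sum is at most its upper limit [y]; the factor 8 instead of
    4 pays for the integer part in [geom]. *)
Lemma sum_min_sqr_geom_le y alpha : 1 < alpha -> 0 <= y -> forall N,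
  \sum_(n < N) Num.min y (geom alpha n)%:R ^+ 2 / (geom alpha n)%:R <=
  8 * alpha / (alpha - 1) * y.
Proof.
move=> a1 y0 N.
have a0 : 0 < alpha by exact: lt_trans a1.
have c0 : 0 <= 4 * alpha / (alpha - 1).
  by rewrite divr_ge0 ?mulr_ge0 ?subr_ge0 ?ltW.
pose phi n := alpha ^+ n * y / (alpha ^+ n + y).
have an0 n : 0 < alpha ^+ n by exact: exprn_gt0.
have step n : Num.min y (geom alpha n)%:R ^+ 2 / (geom alpha n)%:R <=
    2 * (4 * alpha / (alpha - 1)) * (phi n.+1 - phi n).
  set k := (geom alpha n)%:R.
  have k0 : 0 < k by rewrite ltr0n geom_gt0.
  have k1 : 1 <= k by rewrite ler1n geom_gt0.
  have ka : k <= alpha ^+ n by exact: geom_le.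
  (* As [k] is at least 1, rounding down loses at most a factor 2. *)
  have ak : alpha ^+ n <= 2 * k by have := geom_gt alpha n; rewrite -/k; lra.
  have := min_sqr_telescope a1 y0 (an0 n); rewrite -exprS => h.
  apply: (@le_trans _ _ (2 * (Num.min y (alpha ^+ n) ^+ 2 / alpha ^+ n))); last first.
    by rewrite -mulrA ler_pM2l.
  rewrite mulrCA ler_pM//.
  - by rewrite sqr_ge0.
  - by rewrite invr_ge0 ltW.
  - rewrite ler_pXn2r ?nnegrE ?le_min ?y0 ?(ltW (an0 n)) ?(ltW k0)//.
    by rewrite !ge_min lexx ka orbT.
  - by rewrite ler_pdivlMr// mulrC ler_pdivrMr// mulrC.
apply: (@le_trans _ _ (\sum_(n < N)
    2 * (4 * alpha / (alpha - 1)) * (phi n.+1 - phi n))).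
  by apply: ler_sum => n _; exact: step.
rewrite -mulr_sumr (_ : \sum_(i < N) _ = phi N - phi 0%N); last first.
  by rewrite -(big_mkord xpredT (fun i => phi i.+1 - phi i)) telescope_sumr.
rewrite (_ : 8 * alpha / (alpha - 1) = 2 * (4 * alpha / (alpha - 1))); last first.
  by rewrite !mulrA; congr (_ * _ * _); ring.
apply: ler_wpM2l; first by apply: mulr_ge0.
apply: (@le_trans _ _ (phi N)).
  by rewrite gerBl /phi expr0 divr_ge0 ?mulr_ge0 ?addr_ge0.
rewrite /phi ler_pdivrMr ?ltr_pwDl// mulrC ler_wpM2l// lerDl//.
Qed.

Lemma bernoulli_le alpha n : 1 <= alpha -> 1 + n%:R * (alpha - 1) <= alpha ^+ n.
Proof.
move=> a1; elim: n => [|n IH]; first by rewrite mul0r addr0.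
rewrite exprS -natr1; have n0 : 0 <= n%:R * (alpha - 1) :> R.
  by rewrite mulr_ge0// subr_ge0.
by have := ler_wpM2l (le_trans ler01 a1) IH; nra.
Qed.

Lemma expr_unbounded alpha (x : R) : 1 < alpha -> exists n, x < alpha ^+ n.
Proof.
move=> a1; exists (Num.truncn (x / (alpha - 1))).+1.
apply: lt_le_trans (bernoulli_le _ (ltW a1)).
have := truncnS_gt (x / (alpha - 1)); rewrite ltr_pdivrMr ?subr_gt0//; lra.
Qed.

Lemma geom_bracket alpha (x : R) : 1 < alpha -> 1 <= x ->
  exists n, alpha ^+ n <= x < alpha ^+ n.+1.
Proof.
move=> a1 x1; have [n0 xn0] := expr_unbounded x a1.
have ex : exists n, x < alpha ^+ n by exists n0.
case: (ex_minnP ex) => -[|n] xn nmin; first by move: xn; rewrite expr0 ltNge x1.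
exists n; rewrite xn andbT leNgt; apply/negP => /nmin; by rewrite ltnn.
Qed.

(* Between consecutive terms of the geometric subsequence a nondecreasing sum
   varies by a factor at most about [alpha]. *)
Lemma cvg_mean_geom (S : nat -> R) (m : R) : 0 <= m ->
    (forall n, 0 <= S n) -> {homo S : i j / (i <= j)%N >-> i <= j} ->
    (forall j, let alpha := 1 + (j.+1%:R)^-1 in
      S (geom alpha n) / (geom alpha n)%:R @[n --> \oo] --> m) ->
  S n / n%:R @[n --> \oo] --> m.
Proof.
move=> m0 S0 ndS Sgeom; apply/cvgrPdist_le => e e0.
(* With t = 2 (alpha - 1) <= 1, the final upper bound is (m + t) (1 + t) <= m + t (m + 2), which
   must not exceed m + e. *)
pose b := Num.min 1 (e / (m + 2)) / 2.
have m20 : 0 < m + 2 by rewrite ltr_wpDl.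
have b0 : 0 < b by rewrite divr_gt0// lt_min ltr01 divr_gt0.
have [j jb] : exists j, (j.+1%:R)^-1 < b.
  exists (Num.truncn b^-1); rewrite invf_plt ?posrE ?ltr0n//.
  exact: truncnS_gt.
move: (Sgeom j) => /=; set alpha := 1 + _ => Sj.
pose t := 2 * (alpha - 1).
have a1 : 1 < alpha by rewrite ltrDl invr_gt0.
have t0 : 0 < t by rewrite mulr_gt0// subr_gt0.
have tb : t <= Num.min 1 (e / (m + 2)).
  rewrite /t /alpha addrAC subrr add0r mulrC.
  by move: jb; rewrite /b ltr_pdivlMr// => /ltW.
have t1 : t <= 1 by move: tb; rewrite le_min => /andP[].
have te : t * (m + 2) <= e.
  by move: tb; rewrite le_min => /andP[_]; rewrite ler_pdivlMr.
have /cvgrPdist_le/(_ _ t0)[n1 _ Sn1] := Sj.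
(* From this index on, the surplus alpha^n (alpha - 1) absorbs the rounding in [geom], so that
   consecutive terms satisfy k' <= (1 + t) k. *)
have [n2 an2] := expr_unbounded ((1 + t) / (alpha - 1)) a1.
have [N1 _ N1P] : \forall N \near \oo, alpha ^+ (maxn n1 n2).+1 <= N%:R.
  exact: nbhs_infty_ger.
exists (maxn N1 1%N) => // N /=; rewrite geq_max => /andP[/N1P aN N1'].
have N0 : 0 < N%:R :> R by rewrite ltr0n.
have [n /andP[anN aNS]] : exists n, alpha ^+ n <= N%:R < alpha ^+ n.+1.
  by apply: geom_bracket => //; rewrite ler1n.
have : alpha ^+ (maxn n1 n2).+1 < alpha ^+ n.+1 by exact: le_lt_trans aNS.
rewrite ltr_eXn2l// ltnS gtn_max => /andP[n1n n2n].
set k := geom alpha n; set k' := geom alpha n.+1.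
have k0 : 0 < k%:R :> R by rewrite ltr0n geom_gt0.
have k'0 : 0 < k'%:R :> R by rewrite ltr0n geom_gt0.
have kN : (k <= N)%N by rewrite -(ler_nat R) (le_trans (geom_le _ a1)).
have Nk' : (N <= k')%N by rewrite truncn_ge_nat ?ltW// exprn_gt0// (lt_trans ltr01).
have kk' : k'%:R <= (1 + t) * k%:R.
  have h1 := geom_le n.+1 a1; have h2 := geom_gt alpha n.
  have : (1 + t) / (alpha - 1) < alpha ^+ n.
    by rewrite (lt_le_trans an2)// ler_eXn2l// ltnW.
  rewrite ltr_pdivrMr ?subr_gt0//; move: h1 h2; rewrite -/k -/k' exprS /t.
  nra.
have /Sn1 : (n1 <= n)%N by exact: ltnW.
have /Sn1 : (n1 <= n.+1)%N by rewrite ltnW// ltnW.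
rewrite /= -/k -/k' !ler_norml => /andP[Sk' _] /andP[_ Sk].
have {}Sk' : S k' <= (m + t) * k'%:R.
  by rewrite -ler_pdivrMr//; lra.
have {}Sk : (m - t) * k%:R <= S k.
  by rewrite -ler_pdivlMr//; lra.
have SNk' := ndS _ _ Nk'; have SkN := ndS _ _ kN.
have kNR : k%:R <= N%:R :> R by rewrite ler_nat.
have NkR : N%:R <= k'%:R :> R by rewrite ler_nat.
have mt0 : 0 <= m + t by rewrite addr_ge0// ltW.
have tm0 : 0 <= t * m by rewrite mulr_ge0// ltW.
have tt : t * t <= t by rewrite ler_piMl// ltW.
have te' : t <= e by move: te; rewrite mulrDr; lra.
apply/andP; split.
  suff : S N / N%:R <= m + e by lra.
  rewrite ler_pdivrMr// (le_trans SNk')// (le_trans Sk')//.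
  apply: (@le_trans _ _ ((m + t) * ((1 + t) * N%:R))).
    by rewrite ler_wpM2l// (le_trans kk')// ler_wpM2l// addr_ge0// ltW.
  by rewrite mulrA ler_wpM2r//; move: te; rewrite mulrDr; nra.
suff : m - e <= S N / N%:R by lra.
rewrite ler_pdivlMr//; have [mt|mt] := leP (m - t) 0.
  by rewrite (le_trans _ (S0 N))// mulr_le0_ge0//; lra.
rewrite (le_trans _ SkN)// (le_trans _ Sk)//.
have NkR' : N%:R <= (1 + t) * k%:R by exact: le_trans kk'.
have [me|me] := leP (m - e) 0.
  apply: (@le_trans _ _ 0); first by rewrite mulr_le0_ge0.
  by rewrite mulr_ge0// ltW.
apply: (@le_trans _ _ ((m - e) * ((1 + t) * k%:R))); first by rewrite ler_wpM2l// ltW.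
rewrite mulrA ler_wpM2r//.
have : 0 <= e * t by rewrite mulr_ge0// ltW.
by move: te; rewrite mulrDr; nra.
Qed.

End geometric_subsequence.

(** * Almost sure convergence to zero from real-valued moment bounds *)

Lemma nneseries_le_bound (R : realType) (u : nat -> R) (C : R) :
    (forall n, 0 <= u n) -> (forall N, \sum_(n < N) u n <= C) ->
  (\sum_(0 <= n <oo) (u n)%:E <= C%:E)%E.
Proof.
move=> u0 uC; apply: lime_le.
  by apply: is_cvg_nneseries => n _ _; rewrite lee_fin.
by apply: nearW => N /=; rewrite sumEFin lee_fin big_mkord.
Qed.

Lemma ae_cvg0_of_summable (d : measure_display) (T : measurableType d)
    (R : realType) (P : probability T R) (f : nat -> T -> R) (u : nat -> R) (C : R) :
    (forall n, L1 P (f n)) -> (forall n w, 0 <= f n w) ->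
    (forall n, \int[P]_w f n w <= u n) -> (forall N, \sum_(n < N) u n <= C) ->
  {ae P, forall w, f n w @[n --> \oo] --> (0 : R)}.
Proof.
move=> Lf f0 fu uC; apply: ae_cvg0_of_summable_integral => //.
  by move=> n; exact: L1_measurable.
apply: (@le_lt_trans _ _ C%:E); last exact: ltry.
have fE n : (\int[P]_w (f n w)%:E = (\int[P]_w f n w)%:E)%E.
  by rewrite fineK// integrable_fin_num//; exact: Lf.
under eq_eseriesr do rewrite fE.
apply: nneseries_le_bound => [n|N]; first exact: Rintegral_ge0.
by apply: le_trans (uC N); apply: ler_sum => n _; exact: fu.
Qed.

Section Rintegral_sum.
Context (d : measure_display) (T : measurableType d) (R : realType).
Variable P : probability T R.

Lemma RintegralT_sum (I : Type) (s : seq I) (f : I -> T -> R) :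
    (forall i, L1 P (f i)) ->
  \int[P]_w (\sum_(i <- s) f i w) = \sum_(i <- s) \int[P]_w f i w.
Proof.
move=> fL1; elim: s => [|i s IHs].
  by under eq_fun do rewrite big_nil; rewrite RintegralT_cst big_nil.
under eq_fun do rewrite big_cons.
by rewrite RintegralD ?IHs ?big_cons//; [exact: fL1|exact: L1_sum].
Qed.

End Rintegral_sum.

(** * Strong law of large numbers *)

Section strong_law.
Context (d : measure_display) (T : measurableType d) (R : realType).
Variables (P : probability T R) (Y : nat -> {RV P >-> R}).
Hypotheses (iidY : iid Y) (Y_ge0 : forall i w, 0 <= Y i w).
Hypothesis Y_L1 : L1 P (Y 0%N).

Let mY i : measurable_fun [set: T] (Y i). Proof. by []. Qed.

(** Large values are capped at [K] rather than replaced by 0. Where the cap acts, [tr] equals [K],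
    so the second moment of [tr] also bounds the probability of exceeding [K]. *)
Let tr (K : nat) (x : R) : R := Num.min x K%:R.

Let mtr K : measurable_fun [set: R] (tr K).
Proof. exact: measurable_minr. Qed.

Let tr_ge0 K i w : 0 <= tr K (Y i w).
Proof. by rewrite le_min Y_ge0/=. Qed.

Let tr_le K x : tr K x <= K%:R.
Proof. by rewrite ge_min lexx orbT. Qed.

Let trY_L1 K i : L1 P (fun w => tr K (Y i w)).
Proof.
apply: (@L1_le _ _ _ _ _ (fun=> K%:R)) => [||]; last exact: L1_cst.
  exact: (measurableT_comp (mtr K)).
by move=> w; rewrite ger0_norm.
Qed.

Let trY2_L1 K i : L1 P (fun w => tr K (Y i w) ^+ 2).
Proof.
apply: (@L1_le _ _ _ _ _ (fun=> K%:R ^+ 2)) => [||]; last exact: L1_cst.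
  by apply: measurable_funX; exact: (measurableT_comp (mtr K)).
by move=> w; rewrite ger0_norm ?sqr_ge0// lerXn2r ?nnegrE.
Qed.

Let tmean K := \int[P]_w tr K (Y 0%N w).

Let tmean_ge0 K : 0 <= tmean K.
Proof. by apply: Rintegral_ge0 => w _. Qed.

Let tmean_le K : tmean K <= K%:R.
Proof.
rewrite -[leRHS](RintegralT_cst P).
by apply: le_Rintegral => //; [exact: trY_L1|exact: L1_cst].
Qed.

(* The squared centred mean of the variables truncated at [K], plus the number
   of variables affected by the truncation. *)
Let deviation (K : nat) (w : T) : R :=
  ((\sum_(i < K) (tr K (Y i w) - tmean K)) / K%:R) ^+ 2 +
  \sum_(i < K) \1_(`]K%:R, +oo[%classic : set R) (Y i w).

Let sum_indic_ge0 K w :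
  0 <= \sum_(i < K) \1_(`]K%:R, +oo[%classic : set R) (Y i w) :> R.
Proof. by apply: sumr_ge0 => i _; rewrite indicE. Qed.

Let deviation_ge0 K w : 0 <= deviation K w.
Proof. by apply: addr_ge0 => //; exact: sqr_ge0. Qed.

Let indic_L1 K i : L1 P (fun w => \1_(`]K%:R, +oo[%classic : set R) (Y i w)).
Proof.
apply: (@L1_le _ _ _ _ _ (fun=> 1)) => [||]; last exact: L1_cst.
  exact: (measurableT_comp (measurable_indic _)).
by move=> w; rewrite indicE; case: (_ \in _); rewrite ?normr1 ?normr0.
Qed.

(** Each summand of [deviation] contributes one copy of the bound. The variance of the capped sum is
    at most [K] times the second moment, then divided by [K ^+ 2]. The expected count is K P(Y > K),
    and K = K^2 / K = tr^2 / K wherever Y > K. *)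
Let deviationP K : (0 < K)%N -> L1 P (deviation K) /\
  \int[P]_w deviation K w <= 2 * \int[P]_w (tr K (Y 0%N w) ^+ 2 / K%:R).
Proof.
move=> K0; have K0R : 0 < K%:R :> R by rewrite ltr0n.
have [indY idY] := iidY.
pose e := tmean K; pose g x := tr K x - e.
have mg : measurable_fun [set: R] g by exact: measurable_funB.
pose g' : {mfun R >-> R} := mfun_Sub (mem_set mg).
pose Z i : {RV P >-> R} := [the {mfun T >-> R} of g' \o Y i].
have indZ : mutually_independent Z := mutually_independent_comp (fun=> g') indY.
have gY i : L1 P (fun w => g (Y i w)) by apply: L1B => //; exact: L1_cst.
have gnorm i w : `|g (Y i w)| <= K%:R.
  rewrite ler_norml /g; have := tr_ge0 K i w; have := tr_le K (Y i w).
  by have := tmean_ge0 K; have := tmean_le K; rewrite -/e; lra.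
have gYk k i : L1 P (fun w => g (Y i w) ^+ k).
  apply: (@L1_le _ _ _ _ _ (fun=> K%:R ^+ k)) => [||]; last exact: L1_cst.
    by apply: measurable_funX; exact: (measurableT_comp mg).
  by move=> w; rewrite normrX lerXn2r ?nnegrE.
have mgk k : measurable_fun [set: R] (fun x => g x ^+ k) by exact: measurable_funX.
have Z1 i : \int[P]_w Z i w = 0.
  rewrite [LHS](@identically_distributed_Rintegral _ _ _ _ Y g i 0%N)//; last exact: gY.
  by rewrite RintegralB ?RintegralT_cst ?subrr//; [exact: trY_L1|exact: L1_cst].
have Z2 i : \int[P]_w (Z i w ^+ 2) <= \int[P]_w (tr K (Y 0%N w) ^+ 2).
  rewrite [leLHS](@identically_distributed_Rintegral _ _ _ _ Y (fun x => g x ^+ 2) i 0%N)//; last exact: gYk.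
  have -> : (fun w => g (Y 0%N w) ^+ 2) =
      fun w => tr K (Y 0%N w) ^+ 2 - (2 * e) * tr K (Y 0%N w) + e ^+ 2.
    by apply/funext => w; rewrite /g; ring.
  rewrite RintegralD//; last 2 first.
  - by apply: L1B => //; exact: L1Z.
  - exact: L1_cst.
  rewrite RintegralT_cst RintegralB//; [|exact: trY2_L1|exact/L1Z/trY_L1].
  rewrite RintegralZl//; last exact: trY_L1.
  rewrite -/(tmean K) -/e -subr_ge0.
  rewrite (_ : _ - _ = e ^+ 2) ?sqr_ge0//; ring.
(* The centred capped variables are bounded, so their own fourth moment is a finite bound to hand to
   [partial_sum_moments]. *)
have Z4 i : \int[P]_w (Z i w ^+ 4) <= \int[P]_w (g (Y 0%N w) ^+ 4).
  rewrite [leLHS](@identically_distributed_Rintegral _ _ _ _ Y (fun x => g x ^+ 4) i 0%N)//.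
  exact: gYk.
have [S4 _ S2 _] := partial_sum_moments indZ (gYk 4%N) Z1 Z2 Z4 K.
have mS : measurable_fun [set: T] (partial_sum Z K) by exact: measurable_sum.
have S2L1 := @L1_pow4 _ _ _ _ _ 2 mS S4 isT.
have devE : deviation K = fun w => (K%:R ^- 2) * partial_sum Z K w ^+ 2 +
    \sum_(i < K) \1_(`]K%:R, +oo[%classic : set R) (Y i w).
  by apply/funext => w; rewrite /deviation exprMn exprVn mulrC.
have L2 : L1 P (fun w => \sum_(i < K) \1_(`]K%:R, +oo[%classic : set R) (Y i w)).
  exact: L1_sum.
rewrite devE; split; first by apply: L1D => //; exact: L1Z.
rewrite RintegralD//; last exact: L1Z.
rewrite RintegralZl// RintegralT_sum// mulr2n mulrDl mul1r lerD//.
  rewrite RintegralZr//; last exact: trY2_L1.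
  apply: (@le_trans _ _ (K%:R ^- 2 * (K%:R * \int[P]_w (tr K (Y 0%N w) ^+ 2)))).
    by rewrite ler_wpM2l// invr_ge0 exprn_ge0.
  rewrite mulrA [leRHS]mulrC le_eqVlt; apply/orP; left; apply/eqP; congr (_ * _).
  by field; rewrite gt_eqF.
under eq_bigr => i _.
  rewrite (@identically_distributed_Rintegral _ _ _ _ Y \1_`]K%:R, +oo[ i 0%N)//; last first.
    exact: indic_L1.
  over.
rewrite sumr_const card_ord -[_ *+ K]mulr_natl -RintegralZl//; last exact: indic_L1.
apply: le_Rintegral => //.
- exact/L1Z/indic_L1.
- by under eq_fun do rewrite mulrC; exact/L1Z/trY2_L1.
move=> w _; rewrite indicE; case: (boolP (_ \in _)).
  rewrite inE/= in_itv/= andbT => KY; rewrite mulr1 /tr min_r; last exact: ltW.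
  by rewrite expr2 mulfK ?gt_eqF.
by move=> _; rewrite mulr0 divr_ge0// sqr_ge0.
Qed.

Let tmean_cvg (k : nat -> nat) :
    (forall x : R, \forall n \near \oo, x <= (k n)%:R) ->
  tmean (k n) @[n --> \oo] --> \int[P]_w Y 0%N w.
Proof.
move=> kn.
have : (\int[P]_w (tr (k n) (Y 0%N w))%:E @[n --> \oo] -->
    \int[P]_w (Y 0%N w)%:E)%E.
  apply: (@dominated_cvg _ _ _ P setT measurableT _ _ (fun w => (Y 0%N w)%:E)) => //.
  - move=> n; apply/measurable_EFinP; exact: (measurableT_comp (mtr (k n))).
  - move=> w _; apply: cvg_near_cst; apply: filterS (kn (Y 0%N w)) => n Yk.
    by rewrite /tr min_l.
  - by move=> n w _; rewrite gee0_abs ?lee_fin// ge_min lexx.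
move=> h; apply: (fine_cvg (F := \oo)); rewrite fineK//.
exact: integrable_fin_num.
Qed.

Let geom_cvg (alpha : R) : 1 < alpha ->
  {ae P, forall w, partial_sum Y (geom alpha n) w / (geom alpha n)%:R @[n --> \oo]
    --> \int[P]_w Y 0%N w}.
Proof.
move=> a1.
have C0 : 0 <= 8 * alpha / (alpha - 1) :> R.
  by rewrite divr_ge0 ?subr_ge0 ?ltW// mulr_gt0// (lt_trans ltr01).
have devL n := (deviationP (geom_gt0 n a1)).1.
have devE n := (deviationP (geom_gt0 n a1)).2.
have trL n : L1 P (fun w => tr (geom alpha n) (Y 0%N w) ^+ 2 / (geom alpha n)%:R).
  by under eq_fun do rewrite mulrC; exact/L1Z/trY2_L1.
have : {ae P, forall w, deviation (geom alpha n) w @[n --> \oo] --> (0 : R)}.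
  apply: (@ae_cvg0_of_summable _ _ _ _ _ _
    (2 * \int[P]_w (8 * alpha / (alpha - 1) * Y 0%N w)) devL _ devE) => // N.
   rewrite -mulr_sumr.
  (* With the sum inside the integral, [sum_min_sqr_geom_le] applies pointwise. *)
  have -> : \sum_(n < N) \int[P]_w (tr (geom alpha n) (Y 0%N w) ^+ 2 /
      (geom alpha n)%:R) =
      \int[P]_w (\sum_(n < N) (tr (geom alpha n) (Y 0%N w) ^+ 2 / (geom alpha n)%:R)).
    by rewrite RintegralT_sum.
  rewrite ler_wpM2l//.
  apply: (@le_Rintegral _ _ _ _ _ _ (fun w => 8 * alpha / (alpha - 1) * Y 0%N w)) => //.
  - exact: L1_sum.
  - exact: L1Z.
  - by move=> w _; exact: sum_min_sqr_geom_le.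
apply: filterS => w dev0.
have k0 n : 0 < (geom alpha n)%:R :> R by rewrite ltr0n geom_gt0.
have koo x : \forall n \near \oo, x <= (geom alpha n)%:R :> R.
  have [N xN] := expr_unbounded (x + 1) a1; exists N => // n /= Nn.
  have := geom_gt alpha n; have : alpha ^+ N <= alpha ^+ n by rewrite ler_eXn2l.
  by move: xN; lra.
suff h : partial_sum Y (geom alpha n) w / (geom alpha n)%:R - tmean (geom alpha n)
    @[n --> \oo] --> (0 : R).
  rewrite (_ : (fun n => _) = fun n => (partial_sum Y (geom alpha n) w /
      (geom alpha n)%:R - tmean (geom alpha n)) + tmean (geom alpha n)); last first.
    by apply/funext => n; rewrite subrK.
  by rewrite -[X in _ --> X]add0r; exact: cvgD h (tmean_cvg koo).
apply/cvgr0Pnorm_le => e e0.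
(* A deviation below 1 forces the integer count to be 0, so no variable is capped; a deviation of at
   most [e ^+ 2] then bounds the centred mean by [e]. *)
have d0 : 0 < Num.min 1 (e ^+ 2) / 2 by rewrite divr_gt0// lt_min ltr01 exprn_gt0.
move/cvgr0Pnorm_le : dev0 => /(_ _ d0); apply: filterS => n.
set k := geom alpha n; rewrite ger0_norm// => devle.
have dev1 : deviation k w < 1.
  apply: (le_lt_trans devle); rewrite ltr_pdivrMr//.
  by rewrite gt_min; apply/orP; left; lra.
have deve : deviation k w <= e ^+ 2.
  apply: (le_trans devle); rewrite ler_pdivrMr//.
  by rewrite ge_min; apply/orP; right; have := sqr_ge0 e; lra.
have trE (i : 'I_k) : tr k (Y i w) = Y i w.
  rewrite /tr; apply/min_idPl; rewrite leNgt; apply/negP => kY.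
  move: dev1; apply/negP; rewrite -leNgt /deviation [X in _ <= _ + X](bigD1 i)//= indicE.
  rewrite mem_set/= ?in_itv/= ?kY//.
  rewrite addrCA lerDl addr_ge0 ?sqr_ge0//.
  by apply: sumr_ge0 => j _; rewrite indicE.
have SE : (\sum_(i < k) (tr k (Y i w) - tmean k)) / k%:R =
    partial_sum Y k w / k%:R - tmean k.
  under eq_bigr do rewrite trE.
  rewrite sumrB sumr_const card_ord mulrBl -[tmean k *+ k]mulr_natr.
  by rewrite mulfK// gt_eqF// k0.
have : (partial_sum Y k w / k%:R - tmean k) ^+ 2 <= e ^+ 2.
  by apply: le_trans deve; rewrite /deviation SE lerDl.
by move=> xe; rewrite -(@ler_pXn2r _ 2%N) ?nnegrE ?(ltW e0)// real_normK ?num_real.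
Qed.

Lemma strong_law_ge0 :
  {ae P, forall w, partial_sum Y n w / n%:R @[n --> \oo] --> \int[P]_w Y 0%N w}.
Proof.
(* Countably many ratios tending to 1 suffice for the interpolation, so a single null set serves all
   of them. *)
have all_geom : {ae P, forall w, forall j, let alpha := 1 + (j.+1%:R)^-1 : R in
    partial_sum Y (geom alpha n) w / (geom alpha n)%:R @[n --> \oo]
      --> \int[P]_w Y 0%N w}.
  by apply: ae_foralln => j; apply: geom_cvg; rewrite ltrDl invr_gt0.
apply: filterS all_geom => w hw; apply: cvg_mean_geom hw.
- exact: Rintegral_ge0.
- by move=> n; exact: sumr_ge0.
- move=> i j ij; rewrite /partial_sum -!(big_mkord xpredT (fun i => Y i w)).
  by rewrite (big_cat_nat (leq0n i) ij)//= lerDl; exact: sumr_ge0.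
Qed.

End strong_law.

(** * Strong law for nonnegative functions and for signed variables *)

Section strong_law_functions.
Context (d : measure_display) (T : measurableType d) (R : realType).
Variables (P : probability T R) (X : nat -> {RV P >-> R}).
Hypothesis iidX : iid X.

Lemma strong_law_comp (f : R -> R) : measurable_fun [set: R] f ->
    (forall x, 0 <= f x) -> L1 P (fun w => f (X 0%N w)) ->
  {ae P, forall w, (\sum_(i < n) f (X i w)) / n%:R @[n --> \oo] -->
    \int[P]_w f (X 0%N w)}.
Proof.
move=> mf f0 fL1; pose f' : {mfun R >-> R} := mfun_Sub (mem_set mf).
have h := @strong_law_ge0 _ _ _ P _ (iid_comp f' iidX).
by apply: h => //= i w; exact: f0.
Qed.

Lemma strong_law : L1 P (X 0%N) ->
  {ae P, forall w, partial_sum X n w / n%:R @[n --> \oo] --> \int[P]_w X 0%N w}.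
Proof.
move=> XL1; pose fp (x : R) := Num.max x 0; pose fn (x : R) := Num.max (- x) 0.
have mfp : measurable_fun [set: R] fp by exact: measurable_maxr.
have mfn : measurable_fun [set: R] fn.
  by apply: measurable_maxr => //; exact: measurable_funN.
have fpB x : x = fp x - fn x.
  rewrite /fp /fn; case: (lerP 0 x) => x0.
    by rewrite max_r ?subr0// oppr_le0.
  by rewrite max_l ?opprK ?add0r// oppr_ge0 ltW.
have fp0 x : 0 <= fp x by rewrite le_max lexx orbT.
have fn0 x : 0 <= fn x by rewrite le_max lexx orbT.
have L1X : L1 P (fun w => `|X 0%N w|) by exact: integrable_norm.
have Lp : L1 P (fun w => fp (X 0%N w)).
  apply: L1_le L1X; first exact: (measurableT_comp mfp).
  by move=> w; rewrite ger0_norm// ge_max ler_norm normr_ge0.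
have Ln : L1 P (fun w => fn (X 0%N w)).
  apply: L1_le L1X; first exact: (measurableT_comp mfn).
  by move=> w; rewrite ger0_norm// ge_max -normrN ler_norm normr_ge0.
apply: filterS2 (strong_law_comp mfp fp0 Lp) (strong_law_comp mfn fn0 Ln).
move=> w hp hn.
rewrite (_ : (fun n => _) = fun n => (\sum_(i < n) fp (X i w)) / n%:R -
    (\sum_(i < n) fn (X i w)) / n%:R); last first.
  apply/funext => n; rewrite -mulrBl -sumrB; congr (_ / _).
  by apply: eq_bigr => i _; rewrite -fpB.
rewrite (_ : \int[P]_w X 0%N w =
    \int[P]_w fp (X 0%N w) - \int[P]_w fn (X 0%N w)); last first.
  by rewrite -RintegralB//; apply: eq_Rintegral => w' _; rewrite -fpB.
exact: cvgB.
Qed.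

End strong_law_functions.

(** Young's inequality (x + y)^2 <= 5 x^2 + (5/4) y^2, applied twice, gives 125 and (5/4)^3 = 125/64
    < 2. In the dyadic recursion the coefficient of [y ^+ 4] has to be below 3. *)
Lemma exprD4_le (R : realFieldType) (x y : R) :
  (x + y) ^+ 4 <= 125 * x ^+ 4 + 2 * y ^+ 4.
Proof.
have sq u v : (u + v) ^+ 2 <= 5 * u ^+ 2 + 5 / 4 * v ^+ 2 :> R.
  rewrite -subr_ge0 (_ : _ - _ = (2 * u - v / 2) ^+ 2); last by field.
  exact: sqr_ge0.
have p4 (z : R) : z ^+ 4 = (z ^+ 2) ^+ 2 by rewrite -exprM.
rewrite !p4.
have h1 := sq x y.
have h2 := sq (5 * x ^+ 2) (5 / 4 * y ^+ 2).
apply: (@le_trans _ _ ((5 * x ^+ 2 + 5 / 4 * y ^+ 2) ^+ 2)).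
  by rewrite lerXn2r ?nnegrE ?sqr_ge0//; apply: le_trans h1; exact: sqr_ge0.
apply: (le_trans h2); rewrite !exprMn.
by have := sqr_ge0 (y ^+ 2); have := sqr_ge0 (x ^+ 2); lra.
Qed.

(** * Dyadic maximal inequality *)

Section maximal.
Context (d : measure_display) (T : measurableType d) (R : realType).
Variables (P : probability T R) (X : nat -> {RV P >-> R}).
Hypotheses (iidX : iid X) (X4_L1 : L1 P (fun w => X 0%N w ^+ 4)).
Hypothesis X_mean0 : \int[P]_w X 0%N w = 0.

Let block (a n : nat) (w : T) : R := partial_sum (fun i => X (a + i)%N) n w.

Let C : R := \int[P]_w (X 0%N w ^+ 4) + 3 * (\int[P]_w (X 0%N w ^+ 2)) ^+ 2.

Let mX i : measurable_fun [set: T] (X i). Proof. by []. Qed.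

Let mpow n : measurable_fun [set: R] (fun x => x ^+ n).
Proof. exact: measurable_funX. Qed.

Let blockP a n : L1 P (fun w => block a n w ^+ 4) /\
  \int[P]_w (block a n w ^+ 4) <= C * n%:R ^+ 2.
Proof.
have [indX idX] := iidX.
have indXa := mutually_independent_shift a indX.
have Xk k i : (k <= 4)%N -> L1 P (fun w => X i w ^+ k).
  move=> k4; apply: (@identically_distributed_L1 _ _ _ P X _ 0%N i idX (mpow k)).
  exact: L1_pow4.
have Ek k i : (k <= 4)%N -> \int[P]_w (X i w ^+ k) = \int[P]_w (X 0%N w ^+ k).
  move=> k4; apply: (@identically_distributed_Rintegral _ _ _ P X _ i 0%N idX (mpow k)).
  exact: Xk.
have E0 i : \int[P]_w X (a + i)%N w = 0.
  by rewrite -[RHS]X_mean0; exact: (Ek 1%N).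
have := @partial_sum_moments _ _ _ P (fun i => X (a + i)%N)
  (\int[P]_w (X 0%N w ^+ 2)) (\int[P]_w (X 0%N w ^+ 4)) indXa.
case/(_ _ _ _ _ n) => //.
- by move=> i; exact: Xk.
- by move=> i; rewrite Ek.
- by move=> i; rewrite Ek.
move=> L4 _ _ E4; split; first exact: L4.
apply: (le_trans E4); rewrite /C [leRHS]mulrDl lerD//; last by rewrite mulrAC.
rewrite mulrC ler_wpM2l//; first by apply: Rintegral_ge0 => w _; rewrite exprn_even_ge0.
by rewrite -natrX ler_nat -mulnn; case: n {L4 E4} => // n; rewrite leq_pmulr.
Qed.

(* Dominates the fourth powers of all the partial sums of the block of length
   [2 ^ k] that starts at [a]. *)
Fixpoint block_pow4 (k a : nat) (w : T) : R :=
  if k is k'.+1 then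
    block_pow4 k' a w + 2 * block_pow4 k' (a + 2 ^ k')%N w +
    125 * block a (2 ^ k') w ^+ 4
  else X a w ^+ 4.

Let pow4_ge0 (x : R) : 0 <= x ^+ 4.
Proof. exact: exprn_even_ge0. Qed.

Lemma block_pow4_ge0 k a w : 0 <= block_pow4 k a w.
Proof.
elim: k a => [|k IH] a //=.
by rewrite !addr_ge0// mulr_ge0.
Qed.

(** A partial sum that passes the midpoint is the full first half, which takes the coefficient 125,
    plus a partial sum of the second half, which takes 2 and is handled by induction. Adding the
    cases instead of taking a maximum keeps expectations easy to bound. *)
Let block_le k a n w : (n <= 2 ^ k)%N -> block a n w ^+ 4 <= block_pow4 k a w.
Proof.
elim: k a n => [|k IH] a n /=.
  case: n => [|[|//]] _; rewrite /block /partial_sum.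
    by rewrite big_ord0 expr0n.
  by rewrite big_ord1 addn0.
move=> nk; have [nk'|/ltnW nk'] := leqP n (2 ^ k).
  apply: (le_trans (IH a n nk')); rewrite -addrA lerDl addr_ge0// mulr_ge0//.
  exact: block_pow4_ge0.
rewrite -(subnKC nk') /block /partial_sum big_split_ord/=.
apply: (le_trans (exprD4_le _ _)); rewrite addrC lerD//.
apply: (@le_trans _ _ (2 * block_pow4 k (a + 2 ^ k) w)).
  rewrite ler_pM2l//; under eq_bigr do rewrite addnA.
  by apply: IH; rewrite leq_subLR addnn -mul2n -expnS.
by rewrite lerDr block_pow4_ge0.
Qed.

Let C_ge0 : 0 <= C.
Proof.
apply: addr_ge0; last by rewrite mulr_ge0// sqr_ge0.
by apply: Rintegral_ge0 => w _.
Qed.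

(** The recursion for the bound reads M' = (1 + 2) M + 125 C 4^k; with M = 125 C 4^k this is exactly
    4 M. *)
Let block_pow4P k a : L1 P (block_pow4 k a) /\
  \int[P]_w block_pow4 k a w <= 125 * C * 4 ^+ k.
Proof.
elim: k a => [|k IH] a.
  have [L E] := blockP a 1.
  have h : block a 1 = X a.
    by apply/funext => w; rewrite /block /partial_sum big_ord1 addn0.
  move: L E; rewrite h expr1n mulr1 => L E; split; first exact: L.
  rewrite expr0 mulr1; apply: (le_trans E); rewrite ler_peMl//; lra.
have [L1a E1] := IH a; have [L2 E2] := IH (a + 2 ^ k)%N.
have [L3 E3] := blockP a (2 ^ k).
have L12 : L1 P (fun w => block_pow4 k a w + 2 * block_pow4 k (a + 2 ^ k)%N w).
  by apply: L1D => //; exact: L1Z.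
split; first by apply: L1D => //; exact: L1Z.
rewrite [leLHS]RintegralD//; last exact: L1Z.
rewrite RintegralD//; last exact: L1Z.
rewrite !RintegralZl//.
have p : ((2 ^ k)%N%:R : R) ^+ 2 = 4 ^+ k by rewrite natrX exprAC -natrX.
rewrite p in E3; rewrite exprS.
by move: E1 E2 E3; lra.
Qed.

Let sum_inv_le1 N : \sum_(k < N) ((k.+1%:R * k.+2%:R)^-1 : R) <= 1.
Proof.
have -> : \sum_(k < N) ((k.+1%:R * k.+2%:R)^-1 : R) = 1 - N.+1%:R^-1.
  elim: N => [|N IH]; first by rewrite big_ord0 invr1 subrr.
  rewrite big_ord_recr/= IH -[N.+2%:R]natr1.
  have N1 : N.+1%:R != 0 :> R by rewrite pnatr_eq0.
  have N2 : N.+1%:R + 1 != 0 :> R by rewrite natr1 pnatr_eq0.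
  by move: (N.+1%:R : R) N1 N2 => x N1 N2; field; rewrite N1 N2.
by rewrite gerBl invr_ge0.
Qed.

Lemma ln2_ge_half : 2^-1 <= ln (2 : R).
Proof.
have : ln (1 + - 2^-1) <= - 2^-1 :> R by apply: le_ln1Dx; lra.
rewrite (_ : 1 + - 2^-1 = 2^-1 :> R); last by field.
by rewrite lnV ?posrE// lerN2.
Qed.

(** The weights [c k] make the expectations summable, so [block_pow4 k 0] is almost surely o(4^k
    k^2). For 2^l <= n < 2^(l+1), taking k = l + 1 turns this into S_n^4 = o(n^2 (ln n)^2). *)
Lemma partial_sum_sqr_small : {ae P, forall w, forall e : R, 0 < e ->
  \forall n \near \oo, partial_sum X n w ^+ 2 <= e * (n%:R * ln n%:R)}.
Proof.
pose c k : R := (4 ^+ k * (k.+1%:R * k.+2%:R))^-1.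
have c0 k : 0 < c k by rewrite invr_gt0 mulr_gt0 ?exprn_gt0// mulr_gt0.
have : {ae P, forall w, c k * block_pow4 k 0 w @[k --> \oo] --> (0 : R)}.
  apply: (@ae_cvg0_of_summable _ _ _ _ _
    (fun k => 125 * C * (k.+1%:R * k.+2%:R)^-1) (125 * C)).
  - by move=> k; apply: L1Z; exact: (block_pow4P k 0).1.
  - by move=> k w; rewrite mulr_ge0 ?block_pow4_ge0// ltW.
  - move=> k; have [L E] := block_pow4P k 0; rewrite RintegralZl//.
    apply: (le_trans (ler_wpM2l (ltW (c0 k)) E)).
    rewrite /c invfM le_eqVlt; apply/orP; left; apply/eqP.
    have : (4 : R) ^+ k != 0 by rewrite expf_neq0.
    move: ((4 : R) ^+ k) ((k.+1%:R * k.+2%:R : R)^-1) => p u p0.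
    by field.
  - by move=> N; rewrite -mulr_sumr ler_piMr// mulr_ge0.
apply: filterS => w /cvgr0Pnorm_le F0 e e0.
(* 16 = 2 * 8, from 4^(l+1) <= (2 n)^2 and (l + 2) (l + 3) <= (8 ln n)^2. *)
have d0 : 0 < (e / 16) ^+ 2 by rewrite exprn_gt0// divr_gt0.
have [k0 _ k0P] := F0 _ d0.
exists (2 ^ (maxn k0 1))%N => // n /= kn.
have n0 : (0 < n)%N by rewrite (leq_trans _ kn)// expn_gt0.
pose l := trunc_log 2 n.
have ln_ : (2 ^ l <= n)%N by exact: trunc_logP.
have nl : (n < 2 ^ l.+1)%N by exact: trunc_log_ltn.
have kl : (maxn k0 1 <= l)%N by exact: trunc_log_max.
move: kl; rewrite geq_max => /andP[k0l l1].
have := k0P l.+1 (leqW k0l); rewrite ger0_norm; last first.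
  by rewrite mulr_ge0 ?block_pow4_ge0// ltW.
rewrite /c mulrC ler_pdivrMr; last by rewrite mulr_gt0 ?exprn_gt0// mulr_gt0.
move=> Fl.
have S4 : partial_sum X n w ^+ 4 <= block_pow4 l.+1 0 w.
  exact: (@block_le l.+1 0 n w (ltnW nl)).
have lnn : l%:R * 2^-1 <= ln n%:R :> R.
  apply: (@le_trans _ _ (l%:R * ln 2)); first by rewrite ler_wpM2l// ln2_ge_half.
  rewrite mulr_natl -lnXn// ler_ln ?posrE ?exprn_gt0// ?ltr0n//.
  by rewrite -natrX ler_nat.
have l1R : 1 <= l%:R :> R by rewrite ler1n.
have nR : 2 ^+ l <= n%:R :> R by rewrite -natrX ler_nat.
have ln0 : 0 <= ln n%:R :> R by apply: le_trans lnn; rewrite mulr_ge0.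
(* As l >= 1 and l <= 2 ln n, l + 3 <= 4 l <= 8 ln n. *)
have h1 : l.+2%:R * l.+3%:R <= (8 * ln n%:R) ^+ 2 :> R.
  have -> : l.+2%:R = l%:R + 2 :> R by rewrite -addn2 natrD.
  have -> : l.+3%:R = l%:R + 3 :> R by rewrite -addn3 natrD.
  rewrite expr2.
  by apply: ler_pM; rewrite ?addr_ge0//; move: lnn l1R; lra.
have h2 : 4 ^+ l.+1 <= 4 * n%:R ^+ 2 :> R.
  rewrite exprS ler_pM2l// (_ : 4 = 2 ^+ 2 :> R); last by rewrite -natrX.
  by rewrite exprAC lerXn2r ?nnegrE ?exprn_ge0.
have h3 : (partial_sum X n w ^+ 2) ^+ 2 <= (e * (n%:R * ln n%:R)) ^+ 2.
  rewrite -exprM; apply: (le_trans S4); apply: (le_trans Fl).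
  have fe (x y : R) : (e * (x * y)) ^+ 2 =
      (e / 16) ^+ 2 * ((4 * x ^+ 2) * (8 * y) ^+ 2) by field.
  rewrite fe.
  by rewrite ler_pM2l// ler_pM// ?exprn_ge0// mulr_ge0.
rewrite -(@ler_pXn2r _ 2%N)// nnegrE ?sqr_ge0//.
by rewrite !mulr_ge0// ltW.
Qed.

End maximal.

(** * Moments of the normal law *)

Section normal_moments.
Context (R : realType).
Local Notation mu := (@lebesgue_measure R).

(** The change of variables produces the Radon-Nikodym derivative, which agrees almost everywhere
    with [normal_pdf] because both have the same integral over every measurable set. *)
Lemma ge0_integral_normal_prob (m s : R) (f : R -> \bar R) :
    measurable_fun [set: R] f -> (forall x, 0 <= f x)%E ->
  (\int[normal_prob m s]_x f x = \int[mu]_x (f x * (normal_pdf m s x)%:E))%E.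
Proof.
move=> mf f0; have dom := @normal_prob_dominates R m s.
rewrite -(Radon_Nikodym_SigmaFinite.change_of_variables dom)//.
have mpdf : measurable_fun [set: R] (fun x => (normal_pdf m s x)%:E).
  by apply/measurable_EFinP; exact: measurable_normal_pdf.
have ifRN := Radon_Nikodym_SigmaFinite.f_integrable dom.
apply: ae_eq_integral => //.
- by apply: emeasurable_funM => //; exact: measurable_int ifRN.
- exact: emeasurable_funM.
apply: ae_eqe_mul2l; apply: integral_ae_eq => //.
by move=> E _ mE; rewrite -Radon_Nikodym_SigmaFinite.f_integral.
Qed.

Definition reflection (m : R) : R -> measurableTypeR R := fun x => 2 * m - x.

Lemma measurable_reflection (m : R) : measurable_fun [set: R] (reflection m).
Proof. exact: measurable_funB. Qed.

Lemma lebesgue_measure_reflection (m : R) (A : set R) : measurable A ->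
  pushforward mu (reflection m) A = mu A.
Proof.
move=> mA; have mr := measurable_reflection m.
apply/esym/lebesgue_measure_unique => //= _ [[a b]] _ <-.
rewrite /pushforward/=.
rewrite (_ : _ @^-1` _ = `[2 * m - b, 2 * m - a[%classic); last first.
  rewrite /reflection; apply/seteqP; split=> x /=; rewrite !in_itv/= => /andP[? ?].
    by apply/andP; split; lra.
  by apply/andP; split; lra.
rewrite !lebesgue_measure_itv/= !lte_fin ltrD2l ltrN2.
by case: ifP => // _; rewrite -!EFinB; congr (_%:E); ring.
Qed.

(** Lebesgue measure and the density are both invariant under the reflection about [m]. This gives
    the mean of the law without computing an integral. *)
Lemma normal_prob_reflection (m s : R) (f : R -> \bar R) : s != 0 ->
    measurable_fun [set: R] f -> (forall x, 0 <= f x)%E ->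
  (\int[normal_prob m s]_x f (reflection m x) = \int[normal_prob m s]_x f x)%E.
Proof.
move=> s0 mf f0; have mr := measurable_reflection m.
have mfr : measurable_fun [set: R] (fun x => f (reflection m x)).
  exact: (measurableT_comp mf).
have mpdf : measurable_fun [set: R] (fun x => (normal_pdf m s x)%:E).
  by apply/measurable_EFinP; exact: measurable_normal_pdf.
rewrite !ge0_integral_normal_prob//; pose g x := (f x * (normal_pdf m s x)%:E)%E.
have mg : measurable_fun [set: R] g by exact: emeasurable_funM.
have g0 x : (0 <= g x)%E by rewrite mule_ge0// lee_fin normal_pdf_ge0.
have pdfE x : normal_pdf m s (reflection m x) = normal_pdf m s x.
  rewrite normal_pdfE// /normal_fun.
  by have -> : (reflection m x - m) ^+ 2 = (x - m) ^+ 2 by rewrite /reflection; ring.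
transitivity (\int[pushforward mu (reflection m)]_x g x)%E; last first.
  by apply: eq_measure_integral => // A mA _; exact: lebesgue_measure_reflection.
have := @ge0_integral_pushforward _ _ (measurableTypeR R) (measurableTypeR R) R
  (reflection m) mr mu setT g
  measurableT mg (fun x _ => g0 x).
move=> ->; rewrite preimage_setT; apply: eq_integral => x _.
by rewrite /g /= pdfE.
Qed.

Lemma sqr_le_expR (u : R) : 0 <= u -> u ^+ 2 <= 8 * expR (3 / 4 * u).
Proof.
move=> u0.
have h : 3 / 8 * u <= expR (3 / 8 * u).
  by apply: le_trans (expR_ge1Dx _); rewrite lerDr.
have -> : 3 / 4 * u = 3 / 8 * u + 3 / 8 * u by field.
rewrite expRD.
have h0 : 0 <= 3 / 8 * u by rewrite mulr_ge0.
have := ler_pM h0 h0 h h; have := sqr_ge0 u; rewrite expr2; nra.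
Qed.

(** The integrand is dominated by a multiple of the normal density with deviation [2 * s]. With u =
    (x - m)^2 / (2 s^2) the exponents are -u and -u/4, and the gap exp(3u/4) absorbs u^2. The 32 in
    [C] is 4, from (x - m)^4 = 4 s^4 u^2, times 8, from [sqr_le_expR]. *)
Lemma normal_pow4_lty (m s : R) : 0 < s ->
  (\int[normal_prob m s]_x ((x - m) ^+ 4)%:E < +oo)%E.
Proof.
move=> s0; have s0' : s != 0 by rewrite gt_eqF.
have s20 : 2 * s != 0 by rewrite mulf_neq0.
have p0 := normal_peak_gt0 s0'; have p20 := normal_peak_gt0 s20.
pose C := 32 * s ^+ 4 * normal_peak s / normal_peak (2 * s).
have C0 : 0 <= C.
  by rewrite divr_ge0 ?mulr_ge0 ?exprn_ge0// ltW.
have mpdf s' : measurable_fun [set: R] (fun x => (normal_pdf m s' x)%:E).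
  by apply/measurable_EFinP; exact: measurable_normal_pdf.
have m4 : measurable_fun [set: R] (fun x => ((x - m) ^+ 4)%:E).
  by apply/measurable_EFinP/measurable_funX; exact: measurable_funB.
have x40 x : 0 <= (x - m) ^+ 4 by exact: exprn_even_ge0.
rewrite ge0_integral_normal_prob//.
apply: (@le_lt_trans _ _ (\int[mu]_x (C%:E * (normal_pdf m (2 * s) x)%:E))%E).
  apply: ge0_le_integral => //.
  - by move=> x _; rewrite mule_ge0// lee_fin ?normal_pdf_ge0//.
  - by apply: emeasurable_funM => //; exact: mpdf.
  - by apply: measurable_funeM; exact: mpdf.
  - move=> x _; rewrite -!EFinM lee_fin !normal_pdfE// /normal_fun.
    pose u := (x - m) ^+ 2 / (s ^+ 2 *+ 2).
    have u0 : 0 <= u by rewrite divr_ge0 ?mulrn_wge0 ?sqr_ge0.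
    have -> : - (x - m) ^+ 2 / (s ^+ 2 *+ 2) = - u by rewrite mulNr.
    have -> : - (x - m) ^+ 2 / ((2 * s) ^+ 2 *+ 2) = - u + 3 / 4 * u.
      rewrite /u; field; exact: s0'.
    have -> : (x - m) ^+ 4 = 4 * s ^+ 4 * u ^+ 2.
      rewrite /u; field; exact: s0'.
    rewrite expRD.
    have -> : C * (normal_peak (2 * s) * (expR (- u) * expR (3 / 4 * u))) =
        (4 * s ^+ 4 * (normal_peak s * expR (- u))) * (8 * expR (3 / 4 * u)).
      rewrite /C; field; rewrite gt_eqF//.
    rewrite mulrAC; apply: ler_wpM2l; last exact: sqr_le_expR.
    by rewrite !mulr_ge0 ?exprn_ge0 ?expR_ge0// ltW.
rewrite ge0_integralZl_EFin//; last 2 first.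
- by move=> x _; rewrite lee_fin normal_pdf_ge0.
- exact: mpdf.
by rewrite integral_normal_pdf mule1 ltry.
Qed.

(** By reflection, the positive and negative parts of [Y - m] have equal integrals, hence the mean.
    A zero variance would concentrate [Y] at [m], but a law with a density gives no mass to a
    point. *)
Lemma normal_law_moments (d : measure_display) (T : measurableType d)
    (P : probability T R) (Y : {RV P >-> R}) (m s : R) :
    0 < s -> has_normal_law Y m s ->
  [/\ L1 P (fun w => Y w ^+ 4), \int[P]_w Y w = m &
      0 < \int[P]_w ((Y w - m) ^+ 2)].
Proof.
move=> s0 Ylaw; have s0' : s != 0 by rewrite gt_eqF.
have mY : measurable_fun [set: T] Y by [].
(* [normal_prob] is a measure on [measurableTypeR R]. *)
have mY' : @measurable_fun _ _ T (measurableTypeR R) setT Y by [].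
pose Y' : {RV P >-> measurableTypeR R} :=
  @mfun_Sub _ _ T (measurableTypeR R) Y (mem_set mY').
have lawE (f : R -> \bar R) : measurable_fun [set: R] f -> (forall x, 0 <= f x)%E ->
    (\int[P]_w f (Y w) = \int[normal_prob m s]_x f x)%E.
  move=> mf f0.
  rewrite -[LHS](@ge0_integral_distribution _ _ _ (measurableTypeR R) _ P Y' f mf f0).
  by apply: eq_measure_integral => A mA _; exact: Ylaw.
have mYm : measurable_fun [set: T] (fun w => Y w - m) by exact: measurable_funB.
have mxm : measurable_fun [set: R] (fun x => x - m) by exact: measurable_funB.
have LYm4 : L1 P (fun w => (Y w - m) ^+ 4).
  apply/integrableP; split; first exact/measurable_EFinP/measurable_funX.
  under eq_integral do rewrite gee0_abs ?lee_fin ?exprn_even_ge0//.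
  rewrite [ltLHS](lawE (fun x => ((x - m) ^+ 4)%:E)) ?normal_pow4_lty//.
    exact/measurable_EFinP/measurable_funX.
  by move=> x; rewrite lee_fin exprn_even_ge0.
have LY4 : L1 P (fun w => Y w ^+ 4).
  apply: (@L1_le _ _ _ _ _ (fun w => 125 * (Y w - m) ^+ 4 + 2 * m ^+ 4)).
  - exact: measurable_funX.
  - move=> w; rewrite ger0_norm ?exprn_even_ge0//.
    by rewrite -{1}(subrK m (Y w)); exact: exprD4_le.
  - by apply: L1D; [exact: L1Z|exact: L1_cst].
have LYm2 := @L1_pow4 _ _ _ P _ 2 mYm LYm4 isT.
have LYm : L1 P (fun w => Y w - m) := @L1_pow4 _ _ _ P _ 1 mYm LYm4 isT.
have LY : L1 P Y := @L1_pow4 _ _ _ P _ 1 mY LY4 isT.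
split=> //.
- pose fp (x : R) := Num.max (x - m) 0; pose fn (x : R) := Num.max (m - x) 0.
  have mfp : measurable_fun [set: R] fp by exact: measurable_maxr.
  have mfn : measurable_fun [set: R] fn.
    by apply: measurable_maxr => //; exact: measurable_funB.
  have fp0 x : 0 <= fp x by rewrite le_max lexx orbT.
  have fn0 x : 0 <= fn x by rewrite le_max lexx orbT.
  have LnYm : L1 P (fun w => `|Y w - m|) by exact: integrable_norm.
  have Lp : L1 P (fun w => fp (Y w)).
    apply: L1_le LnYm; first exact: (measurableT_comp mfp).
    by move=> w; rewrite ger0_norm// ge_max ler_norm normr_ge0.
  have Ln : L1 P (fun w => fn (Y w)).
    apply: L1_le LnYm; first exact: (measurableT_comp mfn).
    by move=> w; rewrite ger0_norm// ge_max distrC ler_norm normr_ge0.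
  have E : \int[P]_w fp (Y w) = \int[P]_w fn (Y w).
    rewrite /Rintegral; congr fine.
    rewrite (lawE (EFin \o fp)); [|exact/measurable_EFinP|by move=> x; rewrite lee_fin].
    rewrite (lawE (EFin \o fn)); [|exact/measurable_EFinP|by move=> x; rewrite lee_fin].
    rewrite -(@normal_prob_reflection m s (EFin \o fp) s0').
    - apply: eq_integral => x _ /=; rewrite /fp /fn /reflection.
      by have -> : 2 * m - x - m = m - x by ring.
    - exact/measurable_EFinP.
    - by move=> x; rewrite lee_fin.
  have : \int[P]_w (Y w - m) = \int[P]_w fp (Y w) - \int[P]_w fn (Y w).
    rewrite -RintegralB//; apply: eq_Rintegral => w _; rewrite /fp /fn.
    case: (lerP 0 (Y w - m)) => h.
      by rewrite (max_r (_ : m - Y w <= 0)) ?subr0//; lra.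
    by rewrite (max_l (_ : 0 <= m - Y w)); lra.
  rewrite E subrr RintegralB//; last exact: L1_cst.
  by rewrite RintegralT_cst => /eqP; rewrite subr_eq0 => /eqP.
- rewrite lt_neqAle Rintegral_ge0 ?andbT; last by move=> w _; exact: sqr_ge0.
  apply/eqP => E0.
  have /ae_eq_integral_abs : (\int[P]_w `|((Y w - m) ^+ 2)%:E| = 0)%E.
    under eq_integral do rewrite gee0_abs ?lee_fin ?sqr_ge0//.
    rewrite -[LHS]fineK; last exact: integrable_fin_num.
    by rewrite [fine _](esym E0).
  move=> /(_ measurableT); case; first exact/measurable_EFinP/measurable_funX.
  move=> N [mN PN0 NP].
  have mYset : measurable (Y @^-1` [set m]) by exact: measurable_funPTI.
  have PY0 : P (Y @^-1` [set m]) = 0%E.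
    have := Ylaw [set m] (measurable_set1 m); rewrite /distribution/= /pushforward => ->.
    by rewrite /normal_prob integral_set1.
  have : (P [set: T] <= P (N `|` Y @^-1` [set m]))%E.
    apply: le_measure; rewrite ?inE//; first exact: measurableU.
    move=> w _; have [/eqP Ym|Ym] := boolP (Y w == m); first by right.
    left; apply: NP => /= /(_ I)/eqP; rewrite eqe sqrf_eq0 subr_eq0.
    by rewrite (negbTE Ym).
  apply/negP; rewrite -ltNge probability_setT.
  apply: (@le_lt_trans _ _ (P N + P (Y @^-1` [set m]))%E); first exact: measureU2.
  by rewrite PN0 PY0 adde0.
Qed.

End normal_moments.

(** * Limits of the statistic *)

Section deterministic_limits.
Context (R : realType).

Lemma cvg_natV0 : (n%:R^-1 : R) @[n --> \oo] --> (0 : R).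
Proof.
apply/(@gtr0_cvgV0 R nat \oo _ (fun n => n%:R)); last exact: cvgr_idn.
by exists 1%N => // n /= n0; rewrite ltr0n.
Qed.

Lemma ln_affine_sublinear (a : R) : 0 <= a ->
  ln (1 + a * n%:R) / n%:R @[n --> \oo] --> (0 : R).
Proof.
move=> a0; apply/cvgr0Pnorm_le => e e0.
(* Applying ln x < x to x = del (1 + a n) bounds the logarithm by e n / 2 - ln del; the threshold on
   [n] makes the last term at most e n / 2 as well. *)
pose del := e / (2 * (a + 1)).
have a10 : 0 < a + 1 by rewrite ltr_wpDl.
have del0 : 0 < del by rewrite divr_gt0// mulr_gt0.
have [N _ NP] := nbhs_infty_ger (`|ln del| / (e / 2)).
exists (maxn N 1) => // n /=; rewrite geq_max => /andP[/NP Nn n1].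
have n0 : 0 < n%:R :> R by rewrite ltr0n.
have n1R : 1 <= n%:R :> R by rewrite ler1n.
have an0 : 0 <= a * n%:R by rewrite mulr_ge0// ltW.
rewrite ger0_norm; last by rewrite divr_ge0 ?ln_ge0// ?lerDl// ltW.
rewrite ler_pdivrMr//.
have u0 : 0 < 1 + a * n%:R by rewrite ltr_pwDl.
have : ln (del * (1 + a * n%:R)) < del * (1 + a * n%:R).
  by apply: ln_sublinear; rewrite mulr_gt0.
rewrite lnM ?posrE// => h.
have : del * (1 + a * n%:R) <= del * ((a + 1) * n%:R).
  by rewrite ler_pM2l// mulrDl mul1r addrC lerD2l.
have -> : del * ((a + 1) * n%:R) = e / 2 * n%:R.
  rewrite /del invfM -!mulrA; congr (_ * (_ * _)).
  by rewrite mulrA mulVf ?mul1r// gt_eqF.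
move: Nn; rewrite ler_pdivrMr ?divr_gt0// => Nn h2.
by have := ler_norm (- ln del); rewrite normrN; lra.
Qed.

(* [S] and [V] stand for the partial sums of the variables and of their squares. *)
Definition G_of_sums (c S V : R) (n : nat) : R :=
  Num.sqrt (c ^+ 2 / (n%:R + c ^+ 2)) *
  (((n%:R + c ^+ 2) * V) / ((n%:R + c ^+ 2) * V - S ^+ 2)) `^ (n%:R / 2).

Lemma ln_G_cvg (c : R) (S V : nat -> R) (m q : R) : 0 < c -> m ^+ 2 < q ->
    S n / n%:R @[n --> \oo] --> m -> V n / n%:R @[n --> \oo] --> q ->
  ln (G_of_sums c (S n) (V n) n) / n%:R @[n --> \oo] -->
    2^-1 * ln (q / (q - m ^+ 2)).
Proof.
move=> c0 mq Sm Vq; have c20 : 0 < c ^+ 2 by rewrite exprn_gt0.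
have q0 : 0 < q by rewrite (le_lt_trans _ mq)// sqr_ge0.
(* [A] and [B] are the numerator and denominator of the ratio in [G_of_sums], divided by n^2. *)
pose A n := (1 + c ^+ 2 * n%:R^-1) * (V n / n%:R).
pose B n := A n - (S n / n%:R) * (S n / n%:R).
have Aq : A n @[n --> \oo] --> q.
  rewrite -[X in _ --> X]mul1r; apply: cvgM => //.
  rewrite -[X in _ --> X]addr0; apply: cvgD; first exact: cvg_cst.
  by rewrite -[X in _ --> X](mulr0 (c ^+ 2)); apply: cvgM; [exact: cvg_cst|exact: cvg_natV0].
have Bq : B n @[n --> \oo] --> q - m ^+ 2.
  by apply: cvgB => //; rewrite expr2; exact: cvgM.
have qm0 : 0 < q - m ^+ 2 by rewrite subr_gt0.
have ABq : A n / B n @[n --> \oo] --> q / (q - m ^+ 2).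
  by apply: cvgM => //; apply: cvgV => //; rewrite gt_eqF.
have rho0 : 0 < q / (q - m ^+ 2) by exact: divr_gt0.
have lnAB : ln (A n / B n) @[n --> \oo] --> ln (q / (q - m ^+ 2)).
  by apply: (cvg_comp _ _ ABq); exact: continuous_ln.
have lim2 : - (2^-1 * (ln (1 + (c ^+ 2)^-1 * n%:R) / n%:R)) + 2^-1 * ln (A n / B n)
    @[n --> \oo] --> 2^-1 * ln (q / (q - m ^+ 2)).
  rewrite -[X in _ --> X]add0r; apply: cvgD; last by apply: cvgM => //; exact: cvg_cst.
  rewrite -oppr0; apply: cvgN; rewrite -[X in _ --> X](mulr0 2^-1).
  apply: cvgM; first exact: cvg_cst.
  by apply: ln_affine_sublinear; rewrite invr_ge0 ltW.
(* The logarithm splits as in [lim2] only once [n] and the ratio are positive, which holds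
   eventually since the limit q / (q - m^2) is positive. *)
apply: cvg_trans lim2; apply: near_eq_cvg.
have /cvgr_gt/(_ _ rho0) := ABq.
have : \forall n \near \oo, (0 < n)%N by exact: nbhs_infty_gt.
apply: filterS2 => n n0 AB0.
have nR0 : 0 < n%:R :> R by rewrite ltr0n.
have nR0' : n%:R != 0 :> R by rewrite gt_eqF.
have nc0 : 0 < n%:R + c ^+ 2 by rewrite addr_gt0.
have rE : ((n%:R + c ^+ 2) * V n) / ((n%:R + c ^+ 2) * V n - S n ^+ 2) = A n / B n.
  have -> : (n%:R + c ^+ 2) * V n = n%:R ^+ 2 * A n by rewrite /A; field.
  have -> : n%:R ^+ 2 * A n - S n ^+ 2 = n%:R ^+ 2 * B n by rewrite /B; field.
  by rewrite -mulf_div divff ?mul1r// expf_neq0.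
have z0 : 0 < c ^+ 2 / (n%:R + c ^+ 2) by exact: divr_gt0.
have z0' : 0 < Num.sqrt (c ^+ 2 / (n%:R + c ^+ 2)) by rewrite sqrtr_gt0.
have p0 : 0 < (A n / B n) `^ (n%:R / 2) by exact: powR_gt0.
rewrite /G_of_sums rE [ln (Num.sqrt _ * _)]lnM ?posrE//.
have -> : ln (Num.sqrt (c ^+ 2 / (n%:R + c ^+ 2))) =
    2^-1 * ln (c ^+ 2 / (n%:R + c ^+ 2)).
  by rewrite -(powR12_sqrt (ltW z0)) ln_powR.
rewrite ln_powR.
have -> : c ^+ 2 / (n%:R + c ^+ 2) = (1 + (c ^+ 2)^-1 * n%:R)^-1.
  rewrite -[LHS]invrK invf_div mulrDl divff ?gt_eqF//.
  by rewrite addrC [_^-1 * _]mulrC.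
rewrite lnV ?posrE; last by rewrite ltr_pwDl// mulr_ge0// ?invr_ge0 ltW.
by field.
Qed.

(** With e = q / 8 and V_n > q n / 2, the denominator is at least q n^2 / 4, so S_n^2 over it is at
    most ln n / (2 n). The power is then at most n^(1/4), the square root at most c n^(-1/2), and
    the product at most c n^(-1/4). *)
Lemma G_cvg0 (c : R) (S V : nat -> R) (q : R) : 0 < c -> 0 < q ->
    (forall e, 0 < e ->
      \forall n \near \oo, S n ^+ 2 <= e * (n%:R * ln n%:R)) ->
    V n / n%:R @[n --> \oo] --> q ->
  G_of_sums c (S n) (V n) n @[n --> \oo] --> (0 : R).
Proof.
move=> c0 q0 Ssmall Vq; apply/cvgr0Pnorm_le => e e0.
have c20 : 0 < c ^+ 2 by rewrite exprn_gt0.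
have q80 : 0 < q / 8 by rewrite divr_gt0.
have q2 : q / 2 < q by rewrite ltr_pdivrMr//; lra.
have /cvgr_gt/(_ _ q2) Vnear := Vq.
have Nnear := nbhs_infty_ger (c ^+ 4 / e ^+ 4).
have n0near : \forall n \near \oo, (0 < n)%N by exact: nbhs_infty_gt.
apply: filterS3 (Ssmall _ q80) (filterI Vnear Nnear) n0near => n Sn [Vn Nn] n0.
have nR0 : 0 < n%:R :> R by rewrite ltr0n.
have nc0 : 0 < n%:R + c ^+ 2 by rewrite addr_gt0.
have z0 : 0 < c ^+ 2 / (n%:R + c ^+ 2) by exact: divr_gt0.
set N : R := n%:R in nR0 nc0 z0 Sn Vn Nn *.
set L := ln N in Sn *.
have LN : L < N by exact: ln_sublinear.
have L0 : 0 <= L by apply: ln_ge0; rewrite ler1n.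
rewrite /G_of_sums -/N; set s := S n in Sn *; set v := V n in Vn *.
have {}Vn : q / 2 * N < v by rewrite -ltr_pdivlMr.
set D := (N + c ^+ 2) * v - s ^+ 2.
have D0 : q / 4 * N ^+ 2 <= D.
  have h1 : N * (q / 2 * N) <= (N + c ^+ 2) * v.
    apply: ler_pM; [exact: ltW| |by rewrite lerDl ltW|exact: ltW].
    by rewrite !mulr_ge0// ltW.
  have h2 : q / 8 * (N * L) <= q / 8 * (N * N).
    by rewrite ler_pM2l// ler_pM2l// ltW.
  rewrite /D expr2.
  have h3 : N * (q / 2 * N) - q / 8 * (N * N) = q / 4 * (N * N) + q / 8 * (N * N) by field.
  have h4 : 0 <= q / 8 * (N * N) by rewrite !mulr_ge0// ltW.
  by lra.
have qN0 : 0 < q / 4 * N ^+ 2 by rewrite mulr_gt0 ?divr_gt0// exprn_gt0.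
have Dpos : 0 < D by exact: lt_le_trans D0.
have rE : (N + c ^+ 2) * v / D = 1 + s ^+ 2 / D.
  have -> : (N + c ^+ 2) * v = D + s ^+ 2 by rewrite /D subrK.
  by rewrite mulrDl divff// gt_eqF.
have sD0 : 0 <= s ^+ 2 / D by rewrite divr_ge0 ?sqr_ge0// ltW.
have sD : s ^+ 2 / D <= L / (2 * N).
  apply: (@le_trans _ _ (q / 8 * (N * L) / (q / 4 * N ^+ 2))).
    apply: ler_pM => //; [exact: sqr_ge0|by rewrite invr_ge0 ltW|].
    by rewrite lef_pV2// posrE.
  by rewrite le_eqVlt; apply/orP; left; apply/eqP; field; rewrite !gt_eqF.
have powle : (1 + s ^+ 2 / D) `^ (N / 2) <= expR (L / 4).
  rewrite /powR gt_eqF ?ltr_pwDl// ler_expR.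
  have h : ln (1 + s ^+ 2 / D) <= L / (2 * N).
    by apply: le_trans sD; apply: le_ln1Dx; apply: lt_le_trans sD0; rewrite oppr_lt0.
  have := ler_wpM2l (ltW (divr_gt0 nR0 (ltr0Sn R 1))) h.
  by have -> : N / 2 * (L / (2 * N)) = L / 4 by field; rewrite gt_eqF.
have sqle : Num.sqrt (c ^+ 2 / (N + c ^+ 2)) <= c * expR (- (L / 2)).
  have e1 : expR (- (L / 2)) ^+ 2 = N^-1.
    by rewrite -expRM_natl mulrN mulrCA divff// mulr1 expRN lnK// posrE.
  rewrite -(@ler_pXn2r _ 2%N)// ?nnegrE ?sqrtr_ge0 ?mulr_ge0 ?expR_ge0 ?(ltW c0)//.
  rewrite sqr_sqrtr ?(ltW z0)// exprMn e1 ler_pM2l//.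
  by rewrite lef_pV2 ?posrE// lerDl ltW.
rewrite rE ger0_norm; last by rewrite mulr_ge0 ?sqrtr_ge0 ?powR_ge0.
apply: (@le_trans _ _ (c * expR (- (L / 2)) * expR (L / 4))).
  by apply: ler_pM; rewrite ?sqrtr_ge0 ?powR_ge0.
rewrite -mulrA -expRD (_ : - (L / 2) + L / 4 = - (L / 4)); last by field.
rewrite -(@ler_pXn2r _ 4%N)// ?nnegrE ?mulr_ge0 ?expR_ge0 ?(ltW c0) ?(ltW e0)//.
have e4 : expR (- (L / 4)) ^+ 4 = N^-1.
  by rewrite -expRM_natl mulrN mulrCA divff// mulr1 expRN lnK// posrE.
rewrite exprMn e4 ler_pdivrMr// mulrC -ler_pdivrMr//.
by rewrite exprn_gt0.
Qed.

Lemma cvgry_of_ln_linear (g : nat -> R) (L : R) : 0 < L ->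
  ln (g n) / n%:R @[n --> \oo] --> L -> g n @[n --> \oo] --> +oo.
Proof.
move=> L0 gL; apply/cvgryPge => M.
have L2 : L / 2 < L by rewrite ltr_pdivrMr//; lra.
have /cvgr_gt/(_ _ L2) gnear := gL.
have Nnear := nbhs_infty_ger (M / (L / 2)).
have n0near : \forall n \near \oo, (0 < n)%N by exact: nbhs_infty_gt.
apply: filterS3 gnear Nnear n0near => n gn Mn n0.
have nR0 : 0 < n%:R :> R by rewrite ltr0n.
move: gn Mn; rewrite ltr_pdivlMr// ler_pdivrMr ?divr_gt0// => gn Mn.
(* [ln] takes the value 0 at nonpositive arguments, so a positive logarithm forces a positive
   argument. *)
have g0 : 0 < g n.
  rewrite ltNge; apply/negP => /ln0 g0; move: gn; rewrite g0 ltNge.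
  by rewrite mulr_ge0// ltW// divr_gt0.
have := ln_sublinear g0; rewrite mulrC in Mn; move: gn Mn; lra.
Qed.

End deterministic_limits.

(** * Growth rate under finite second moments, and the three conclusions *)

Section growth_rate.
Context (d : measure_display) (T : measurableType d) (R : realType).
Variables (P : probability T R) (X : nat -> {RV P >-> R}).
Hypothesis iidX : iid X.

Lemma strong_law_sqr : L1 P (fun w => X 0%N w ^+ 2) ->
  {ae P, forall w, partial_sum_sq X n w / n%:R @[n --> \oo] -->
    \int[P]_w (X 0%N w ^+ 2)}.
Proof.
have m2 : measurable_fun [set: R] (fun x => x ^+ 2) by exact: measurable_funX.
exact: (strong_law_comp iidX m2 (fun x => sqr_ge0 x)).
Qed.

Lemma growth_rate (c : R) : 0 < c -> L1 P (X 0%N) ->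
    L1 P (fun w => X 0%N w ^+ 2) ->
    (\int[P]_w X 0%N w) ^+ 2 < \int[P]_w (X 0%N w ^+ 2) ->
  {ae P, forall w, ln (G c X n w) / n%:R @[n --> \oo] -->
    2^-1 * ln (\int[P]_w (X 0%N w ^+ 2) /
      (\int[P]_w (X 0%N w ^+ 2) - (\int[P]_w X 0%N w) ^+ 2))}.
Proof.
move=> c0 L1X L2X vpos.
apply: filterS2 (strong_law iidX L1X) (strong_law_sqr L2X) => w hS hV.
exact: ln_G_cvg.
Qed.

End growth_rate.

Theorem proposition4p10 (d : measure_display) (T : measurableType d)
    (R : realType) (P : probability T R) (X : nat -> {RV P >-> R})
    (c : R) (c_gt0 : 0 < c) (X_iid : iid X) :
  [/\ (forall mu sigma : R, 0 < sigma ->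
        P.-integrable [set: T] (EFin \o X 0%N) ->
        ('E_P[X 0%N] = mu%:E)%E -> ('V_P[X 0%N] = (sigma ^+ 2)%:E)%E ->
        {ae P, forall w,
          ln (G c X n w) / n%:R @[n --> \oo] -->
            2^-1 * ln (1 + mu ^+ 2 / sigma ^+ 2)}),
      (forall mu sigma : R, mu != 0 -> 0 < sigma ->
        has_normal_law (X 0%N) mu sigma ->
        {ae P, forall w,
          G c X n w @[n --> \oo] --> +oo /\
          (0 < limn_einf (fun n => (n%:R^-1 * ln (G c X n w))%:E))%E})
    & (forall sigma : R, 0 < sigma ->
        has_normal_law (X 0%N) 0 sigma ->
        {ae P, forall w, G c X n w @[n --> \oo] --> (0 : R)})].
Proof.
have mX0 : measurable_fun [set: T] (X 0%N) by [].
split.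
- move=> mu sigma s0 LX EX VX.
  have s20 : 0 < sigma ^+ 2 by rewrite exprn_gt0.
  have mE : \int[P]_w X 0%N w = mu.
    by move: EX; rewrite unlock /Rintegral => ->.
  have vE : (\int[P]_w ((X 0%N w - mu) ^+ 2)%:E = (sigma ^+ 2)%:E)%E.
    rewrite -VX /variance unlock EX/= unlock; apply: eq_integral => w _.
    by rewrite expr2.
  (* Finiteness of the variance gives integrability of the centred square; that of the square
     follows by adding an affine function of the integrable [X 0]. *)
  have LXm2 : L1 P (fun w => (X 0%N w - mu) ^+ 2).
    apply/integrableP; split.
      by apply/measurable_EFinP/measurable_funX; exact: measurable_funB.
    under eq_integral do rewrite gee0_abs ?lee_fin ?sqr_ge0//.
    by rewrite [ltLHS]vE ltry.
  have LX2mu : L1 P (fun w => 2 * mu * X 0%N w - mu ^+ 2).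
    by apply: L1B; [exact: L1Z|exact: L1_cst].
  have X2E : (fun w => X 0%N w ^+ 2) =
      fun w => (X 0%N w - mu) ^+ 2 + (2 * mu * X 0%N w - mu ^+ 2).
    by apply/funext => w; ring.
  have LX2 : L1 P (fun w => X 0%N w ^+ 2) by rewrite X2E; exact: L1D.
  have qE : \int[P]_w (X 0%N w ^+ 2) = sigma ^+ 2 + mu ^+ 2.
    rewrite [X in Rintegral _ _ X]X2E RintegralD//.
    rewrite [X in X + _](_ : _ = sigma ^+ 2); last by rewrite /Rintegral vE.
    rewrite RintegralB//; [|exact: L1Z|exact: L1_cst].
    by rewrite RintegralZl// mE RintegralT_cst; ring.
  have := @growth_rate _ _ _ P X X_iid c c_gt0 LX LX2.
  rewrite mE qE ltrDr => /(_ s20).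
  have -> : (sigma ^+ 2 + mu ^+ 2) / (sigma ^+ 2 + mu ^+ 2 - mu ^+ 2) =
      1 + mu ^+ 2 / sigma ^+ 2.
    by rewrite addrK mulrDl divff// gt_eqF.
  by [].
- move=> mu sigma mu0 s0 Xlaw.
  have [LX4 mE vpos] := normal_law_moments s0 Xlaw.
  have LX2 := @L1_pow4 _ _ _ P _ 2 mX0 LX4 isT.
  have LX : L1 P (X 0%N) := @L1_pow4 _ _ _ P _ 1 mX0 LX4 isT.
  have vE : \int[P]_w ((X 0%N w - mu) ^+ 2) =
      \int[P]_w (X 0%N w ^+ 2) - mu ^+ 2.
    have -> : (fun w => (X 0%N w - mu) ^+ 2) =
        fun w => X 0%N w ^+ 2 - (2 * mu * X 0%N w - mu ^+ 2).
      by apply/funext => w; ring.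
    rewrite RintegralB//; last by apply: L1B; [exact: L1Z|exact: L1_cst].
    rewrite RintegralB//; [|exact: L1Z|exact: L1_cst].
    by rewrite RintegralZl// mE RintegralT_cst; ring.
  have mu20 : 0 < mu ^+ 2 by rewrite exprn_even_gt0.
  have := @growth_rate _ _ _ P X X_iid c c_gt0 LX LX2.
  rewrite mE; set q := \int[P]_w (X 0%N w ^+ 2) in vE *.
  rewrite vE subr_gt0 in vpos => /(_ vpos).
  set L := 2^-1 * _.
  (* As [mu] is nonzero, the ratio q / (q - mu^2) exceeds 1. *)
  have L0 : 0 < L.
    rewrite mulr_gt0// ln_gt0// ltr_pdivlMr ?subr_gt0// mul1r; lra.
  apply: filterS => w GL; split; first exact: cvgry_of_ln_linear GL.
  have : (n%:R^-1 * ln (G c X n w))%:E @[n --> \oo] --> L%:E.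
    apply: cvg_EFin; first exact: nearW.
    by apply: cvg_trans GL; apply: near_eq_cvg; apply: nearW => n /=; rewrite mulrC.
  by move=> /cvg_limn_einf_sup[-> _]; rewrite lte_fin.
- move=> sigma s0 Xlaw.
  have [LX4 mE vpos] := normal_law_moments s0 Xlaw.
  have LX2 := @L1_pow4 _ _ _ P _ 2 mX0 LX4 isT.
  have q0 : 0 < \int[P]_w (X 0%N w ^+ 2).
    by under eq_Rintegral do rewrite -[X 0%N _]subr0.
  apply: filterS2 (partial_sum_sqr_small X_iid LX4 mE) (strong_law_sqr X_iid LX2).
  move=> w hS hV; exact: G_cvg0 hV.
Qed.
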